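(* For every integer $t\ge 1$ there is a constant $c=c(t)$ such that for every $n\ge 1$, every simple topological graph $G$ with $n$ vertices that does not contain a set of $t$ edges all disjoint from another set of $t$ edges (that is, there are no two sets $A,B\subseteq E(G)$ with $|A|=|B|=t$ such that every edge of $A$ is disjoint from every edge of $B$) satisfies $|E(G)|\le c\,n$. In other words, for constant $t$, the maximum number of edges in such a graph is $O(n)$.
   Context: All graphs are finite, undirected, without loops or multiple edges. A topological graph is a graph drawn in the plane such that its vertices are represented by distinct points and its edges by Jordan arcs between the corresponding points, satisfying: (a) no edge intersects any vertex other than its endpoints; (b) any two edges have only a finite number of interior points in common; (c) no three edges have a common interior point; (d) if two edges share an interior point, then they properly cross at that point. A topological graph is simple if every pair of edges intersect in at most one point (a common endpoint counts as an intersection point). Two edges cross if their interiors share a point, and they are disjoint if they neither share a common vertex nor cross. *)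

(* Defs.v *)
From HB Require Import structures.
From mathcomp Require Import all_boot all_order all_algebra.
From mathcomp Require Import all_classical all_reals all_analysis.

Set Implicit Arguments.
Unset Strict Implicit.
Unset Printing Implicit Defensive.

Import Order.TTheory GRing.Theory Num.Theory numFieldNormedType.Exports.
Local Open Scope classical_set_scope.
Local Open Scope ring_scope.

Local Notation plane R := (Real.sort R * Real.sort R)%type.

(* Arcs are point sets, so they carry no orientation. *)
Definition jordan_arc (R : realType) (p q : plane R) (a : set (plane R)) : Prop :=
  exists gamma : R -> plane R,
    [/\ {within `[0, 1], continuous gamma},
        {in `[0, 1] &, injective gamma},
        gamma 0 = p, gamma 1 = q & a = gamma @` `[0, 1]].

(* [h : U -> plane] is a homeomorphism with inverse [g], carrying [(a, b)] near
   [p] to the pair of coordinate axes near the origin; touchings are thereby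
   excluded. Since [a `&` U] must be carried onto a full line, [U] contains no
   endpoint of [a], and likewise for [b]. *)
Definition properly_cross_at (R : realType) (a b : set (plane R)) (p : plane R)
    : Prop :=
  exists (U : set (plane R)) (h g : plane R -> plane R),
    [/\ open U /\ U p,
        {within U, continuous h} /\ continuous g,
        forall x, U x -> g (h x) = x,
        forall y, U (g y) /\ h (g y) = y &
        [/\ h p = (0, 0),
            h @` (a `&` U) = [set z | z.2 = 0] &
            h @` (b `&` U) = [set z | z.1 = 0]]].

(* An edge is the set of its two endpoints; [edge_arc] is relevant only on
   members of [edges]. *)
Record drawing (R : realType) := Drawing {
  vertex : finType;
  edges : {set {set vertex}};
  edges_card2 : forall e, e \in edges -> #|e| = 2%N;
  vertex_point : vertex -> plane R;
  edge_arc : {set vertex} -> set (plane R);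
  vertex_point_inj : injective vertex_point;
  edge_arcP : forall u v, [set u; v]%SET \in edges ->
    jordan_arc (vertex_point u) (vertex_point v) (edge_arc [set u; v]%SET)
}.

Definition edge_interior (R : realType) (G : drawing R) (e : {set vertex G})
    : set (plane R) :=
  edge_arc e `\` [set vertex_point v | v in [set v : vertex G | v \in e]].

Definition topological_graph (R : realType) (G : drawing R) : Prop :=
  [/\ forall (e : {set vertex G}) (v : vertex G),
        e \in edges G -> edge_arc e (vertex_point v) -> v \in e,
      forall e f : {set vertex G}, e \in edges G -> f \in edges G -> e != f ->
        finite_set (edge_interior e `&` edge_interior f),
      forall e f g : {set vertex G},
        e \in edges G -> f \in edges G -> g \in edges G ->
        e != f -> f != g -> e != g ->
        edge_interior e `&` edge_interior f `&` edge_interior g = set0 &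
      forall (e f : {set vertex G}) (p : plane R),
        e \in edges G -> f \in edges G -> e != f ->
        (edge_interior e `&` edge_interior f) p ->
        properly_cross_at (edge_arc e) (edge_arc f) p].

Definition simple_drawing (R : realType) (G : drawing R) : Prop :=
  forall e f : {set vertex G}, e \in edges G -> f \in edges G -> e != f ->
    forall p q : plane R,
      (edge_arc e `&` edge_arc f) p -> (edge_arc e `&` edge_arc f) q -> p = q.

Definition edges_cross (R : realType) (G : drawing R) (e f : {set vertex G})
    : Prop :=
  edge_interior e `&` edge_interior f !=set0.

(* An edge is not disjoint from itself, as it shares its vertices. *)
Definition edges_disjoint (R : realType) (G : drawing R) (e f : {set vertex G})
    : Prop :=
  (e :&: f)%SET = finset.set0 /\ ~ edges_cross e f.

(* Main.v *)
(** Parity of crossings.  For two disjoint vertex pairs, the number of crossings of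
    the arcs [uw] and [ab] is, modulo 2, the winding number of [(s, t) |-> e s - f t]
    along the boundary of the unit square.  Computing winding numbers with an arbitrary
    branch of the complex square root gives, for vertex-disjoint edges [e = uw], [f = ab],
      cross e f = x e a + x e b + x f u + x f w + B u a + B u b + B w a + B w b  (mod 2)
    where [B] is a tournament on the vertices.  Near a proper crossing the winding number
    is odd by Borsuk-Ulam: the map is homotopic to [z |-> g (z / 2) - g (- z / 2)].
    Summed over the 15 independent pairs of a system of ten paths joining five vertices,
    all terms but an odd constant cancel.  In a bipartite graph, paths between vertices of
    one colour have even length, so that two independent paths of the system must meet or
    contain a pair of disjoint edges.

    Counting.  A minimal subgraph whose density is at least a slowly increasing function of
    its number [h] of vertices expands up to a polylogarithmic factor.  Hence the pairs of
    vertices of a monochromatic clique of size at least [h / 16] can be routed along paths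
    whose vertex loads have square sum at most [h ^ 3] times a polylogarithm.  Each of the
    order [h ^ 5] five-tuples of the clique yields two meeting paths, which are few, or a
    pair of disjoint edges.  By a weighted Kovari-Sos-Turan argument the disjointness
    relation, being [K_{t,t}]-free, cannot provide enough of the latter. *)

From Stdlib Require Import Ring.
Require Import Defs.
From mathcomp Require Import all_boot all_order all_algebra.
From mathcomp Require Import zify.

Set Implicit Arguments.
Unset Strict Implicit.
Unset Printing Implicit Defensive.

(** * Routing and counting *)

Section Graph.
Variables (V : finType) (E : {set {set V}}).
Hypothesis E2 : forall e, e \in E -> #|e| = 2.

Definition bichromatic (chi : V -> bool) : {set {set V}} :=
  [set e in E | [exists u in e, exists v in e, chi u != chi v]].

(** Averaging over all colourings: each edge is bichromatic in exactly half of them. *)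
Lemma bichromatic_half : exists chi : {ffun V -> bool}, #|E| <= 2 * #|bichromatic chi|.
Proof.
pose T := #|{: {ffun V -> bool}}|.
have half e : e \in E ->
    2 * #|[set chi : {ffun V -> bool} | e \in bichromatic chi]| = T.
  move=> eE; have /eqP/cards2P [u [v [uv Ee]]] := E2 eE.
  (* Recolouring [u] is an involution exchanging the colourings that separate [u] from [v] with
     those that do not. *)
  pose flipu (chi : {ffun V -> bool}) := [ffun x => (x == u) (+) chi x].
  have flipK : involutive flipu by move=> chi; apply/ffunP => x; rewrite !ffunE addKb.
  have bi (chi : {ffun V -> bool}) : (e \in bichromatic chi) = (chi u != chi v).
    rewrite inE eE /=; apply/idP/idP; last first.
      by move=> h; apply/existsP; exists u; rewrite Ee set21; apply/existsP; exists v; rewrite set22.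
    case/existsP => x /andP[xe] /existsP[y /andP[ye]].
    move: xe ye; rewrite Ee !inE => /orP[/eqP ->|/eqP ->] /orP[/eqP ->|/eqP ->] //.
    by rewrite eqxx.
    by rewrite eq_sym.
    by rewrite eqxx.
  have -> : [set chi : {ffun V -> bool} | e \in bichromatic chi] =
      [set chi : {ffun V -> bool} | chi u != chi v].
    by apply/setP => chi; rewrite [LHS]in_set [RHS]in_set bi.
  have -> : T = #|[set chi : {ffun V -> bool} | chi u != chi v]| +
      #|~: [set chi : {ffun V -> bool} | chi u != chi v]| by rewrite cardsC.
  rewrite mul2n -addnn; congr (_ + _).
  rewrite -(card_imset _ (inv_inj flipK)); apply: eq_card => chi.
  rewrite -[chi in LHS]flipK mem_imset; last exact: inv_inj.
  have vu : (v == u) = false by rewrite eq_sym; exact/negbTE.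
  by rewrite !inE !ffunE eqxx vu /=; case: (chi u); case: (chi v).
have sum : 2 * \sum_(chi : {ffun V -> bool}) #|bichromatic chi| = #|E| * T.
  under eq_bigr => chi _ do rewrite -sum1_card big_mkcond /=.
  rewrite exchange_big /= big_distrr /=.
  rewrite -sum_nat_const [RHS]big_mkcond /=; apply: eq_bigr => e _.
  case: ifP => eE; last by rewrite big1 ?muln0 // => chi _; rewrite inE eE.
  rewrite -(half e eE) -[in RHS]sum1_card [in RHS]big_mkcond /=; congr (_ * _).
  by apply: eq_bigr => chi _; rewrite [in RHS]in_set.
apply/existsP; apply: contraT; rewrite negb_exists => /forallP no.
have : 2 * \sum_(chi : {ffun V -> bool}) #|bichromatic chi| < #|E| * T; last by rewrite sum ltnn.
rewrite big_distrr /= mulnC -sum_nat_const.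
have [chi0] : {chi0 : {ffun V -> bool} | true} by exists [ffun=> true].
move=> _; rewrite (bigD1 chi0) //= [X in _ < X](bigD1 chi0) //=.
rewrite -addSn leq_add //; first by rewrite ltnNge no.
by apply: leq_sum => chi _; rewrite ltnW // ltnNge no.
Qed.

Definition inside (S : {set V}) : {set {set V}} := [set e in E | e \subset S].

(** An edge with an end in [A] cannot leave [A :|: K]; every other edge within [S] avoids [A]. *)
Lemma inside_separation (S A K : {set V}) :
  (forall u v, u \in A -> v \in S -> [set u; v] \in E -> v \in A :|: K) ->
  #|inside S| <= #|inside (A :|: K)| + #|inside (S :\: A)|.
Proof.
move=> sep; apply: leq_trans (leq_card_setU _ _); apply: subset_leq_card.
apply/subsetP => e; rewrite !inE => /andP[eE eS]; rewrite eE /=.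
have /eqP/cards2P [u [v [uv Ee]]] := E2 eE.
move: eS; rewrite Ee !subUset !sub1set => /andP[uS vS].
have [uA|uA] := boolP (u \in A).
  by rewrite inE uA /= (sep u) // -Ee.
have [vA|vA] := boolP (v \in A).
  by rewrite [v \in _]inE vA andbT (sep v) // setUC -Ee.
by apply/orP; right; rewrite !inE uA vA uS.
Qed.

Variable c : nat.

(* Density at least [c * (2 - 1 / k.+1)], where [k] is the integer part of [log2 #|S|]. *)
Definition dense (S : {set V}) : bool :=
  (S != set0) && (c * (2 * trunc_log 2 #|S|).+1 * #|S| <= (trunc_log 2 #|S|).+1 * #|inside S|).

Lemma dense_setT : 0 < #|V| -> 2 * c * #|V| <= #|E| -> dense setT.
Proof.
move=> V0 h; rewrite /dense -card_gt0 cardsT V0 /=.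
have -> : inside setT = E by apply/setP => e; rewrite !inE subsetT andbT.
set k := trunc_log _ _; apply: leq_trans (leq_mul (leqnn k.+1) h).
have -> : c * (2 * k).+1 * #|V| = (2 * k).+1 * (c * #|V|) by rewrite mulnAC mulnC.
have -> : k.+1 * (2 * c * #|V|) = (2 * k).+2 * (c * #|V|).
  by rewrite -mulnA mulnA; congr (_ * _); lia.
by rewrite leq_mul2r leqnSn orbT.
Qed.

Lemma min_dense : 0 < #|V| -> 2 * c * #|V| <= #|E| ->
  exists2 S, dense S & forall S', dense S' -> #|S| <= #|S'|.
Proof.
move=> V0 h; have d := dense_setT V0 h.
by case: (arg_minnP (fun S : {set V} => #|S|) d) => S dS min; exists S.
Qed.

(** Both [A :|: K] and [S :\: A] are smaller than [S], hence not dense. As [A :|: K] has at most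
    half of the vertices, its logarithm is smaller than [k = trunc_log 2 #|S|], so its density stays
    below [c * (2 - 1 / k)], whereas that of [S] is at least [c * (2 - 1 / k.+1)]. Adding up edges,
    this gap of order [c / k ^ 2] on [A] has to be made up by [K]. *)
Lemma min_dense_expands (S A K : {set V}) : dense S -> (forall S', dense S' -> #|S| <= #|S'|) ->
  A != set0 -> A \subset S -> K \subset S -> [disjoint A & K] ->
  (forall u v, u \in A -> v \in S -> [set u; v] \in E -> v \in A :|: K) ->
  2 * #|A :|: K| <= #|S| ->
  #|A| <= 2 * (trunc_log 2 #|S|).+1 ^ 2 * #|K|.
Proof.
move=> /andP[S0 dS] min A0 AS KS AK sep small.
have cAK : #|A :|: K| = #|A| + #|K| by rewrite cardsU disjoint_setI0 // cards0 subn0.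
have cSA : #|S :\: A| = #|S| - #|A| by rewrite cardsD (setIidPr AS).
have a0 : 0 < #|A| by rewrite card_gt0.
have le := inside_separation sep.
have d1 : ~~ dense (A :|: K) by apply/negP => /min; lia.
have d2 : ~~ dense (S :\: A) by apply/negP => /min; lia.
move: d1 d2; rewrite /dense -!card_gt0 cAK cSA !negb_and -!ltnNge.
have -> /= : (#|A| + #|K| < 1) = false by lia.
have -> /= : (#|S| - #|A| < 1) = false by lia.
have : (trunc_log 2 (#|A| + #|K|)).+1 <= trunc_log 2 #|S|.
  have S1 : 1 < #|S| by lia.
  by rewrite (trunc_log2S S1) ltnS; apply: leq_trunc_log; lia.
have : trunc_log 2 (#|S| - #|A|) <= trunc_log 2 #|S| by apply: leq_trunc_log; lia.
move: dS le small a0; rewrite cAK.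
move: (trunc_log 2 #|S|) (trunc_log 2 (#|A| + #|K|)) (trunc_log 2 (#|S| - #|A|)) => k i j.
have : #|A| <= #|S| by exact: subset_leq_card.
move: #|inside S| #|inside (A :|: K)| #|inside (S :\: A)| #|A| #|K| #|S|.
move=> n n1 n2 a b h ah dS le small a0 jk ik d1 d2.
(* The ratio [(2 * i).+1 / i.+1] increases with [i], so [i] may be replaced by [k - 1] here, and [j]
   by [k] in [e2]. *)
have e1 : k * n1 <= c * (2 * k).-1 * (a + b).
  have k0 : 0 < k by lia.
  rewrite -(leq_pmul2l (ltn0Sn i)).
  have i1 : i.+1 * n1 * k <= c * (2 * i).+1 * (a + b) * k by rewrite leq_mul2r ltnW ?orbT.
  apply: leq_trans (_ : c * (2 * i).+1 * (a + b) * k <= _); first by lia.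
  have -> : c * (2 * i).+1 * (a + b) * k = (c * (a + b)) * ((2 * i).+1 * k) by lia.
  have -> : i.+1 * (c * (2 * k).-1 * (a + b)) = (c * (a + b)) * ((2 * k).-1 * i.+1) by lia.
  by rewrite leq_mul2l; apply/orP; right; nia.
have e2 : k.+1 * n2 < c * (2 * k).+1 * (h - a).
  rewrite -(ltn_pmul2l (ltn0Sn j)).
  have j1 : j.+1 * n2 * k.+1 < c * (2 * j).+1 * (h - a) * k.+1 by rewrite ltn_mul2r.
  apply: leq_trans (_ : c * (2 * j).+1 * (h - a) * k.+1 <= _); first by lia.
  have -> : c * (2 * j).+1 * (h - a) * k.+1 = (c * (h - a)) * ((2 * j).+1 * k.+1) by lia.
  have -> : j.+1 * (c * (2 * k).+1 * (h - a)) = (c * (h - a)) * ((2 * k).+1 * j.+1) by lia.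
  by rewrite leq_mul2l; apply/orP; right; nia.
have k0 : 0 < k by lia.
have e3 : k * (c * (2 * k).+1 * h) < k.+1 * (c * (2 * k).-1 * (a + b)) + k * (c * (2 * k).+1 * (h - a)).
  apply: leq_ltn_trans (_ : k.+1 * (k * n1) + k * (k.+1 * n2) < _).
    apply: leq_trans (_ : k * (k.+1 * (n1 + n2)) <= _).
      by rewrite leq_mul2l (leq_trans dS) ?orbT // leq_mul2l le orbT.
    by rewrite mulnDr mulnDr [k.+1 * (k * _)]mulnCA.
  by rewrite -addnS leq_add ?ltn_pmul2l // leq_mul2l e1 orbT.
have e4 : k * (2 * k).+1 * a < k.+1 * (2 * k).-1 * (a + b).
  have c0 : 0 < c by case: (c) e3 => //; rewrite !mul0n !muln0.
  rewrite -(ltn_pmul2l c0).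
  have hE : h = a + (h - a) by lia.
  by move: e3; rewrite {1}hE; nia.
have kX : k * (2 * k).+1 = (k.+1 * (2 * k).-1).+1 by nia.
move: e4; rewrite {}kX; set X := k.+1 * _ => e4.
have XK : X <= 2 * k.+1 ^ 2 by rewrite /X -mulnn; nia.
have aX : a <= X * b by move: e4; rewrite mulSn mulnDr; lia.
by apply: leq_trans aX _; rewrite leq_mul2r XK orbT.
Qed.

End Graph.

(** * Balls for vertex weights *)

Section Burning.
Variables (V : finType) (adj : rel V) (S T : {set V}) (w : V -> nat) (r : V).
Hypothesis w0 : forall v, 0 < w v.
Hypothesis TS : T \subset S.
Hypothesis rT : r \in T.

Definition weight (s : seq V) : nat := \sum_(v <- s) w v.

Definition route (S : {set V}) (x y : V) (p : seq V) : bool :=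
  [&& path adj x p, last x p == y & all (fun v => v \in S) (x :: p)].

(* A fire started at [r] at time 0 takes [w v] steps to burn [v] down, and then spreads to
   the neighbours of [v]: [burned n] below is the ball of radius [n] for the vertex weights
   [w]. *)
Fixpoint burn (n : nat) (v : V) : nat :=
  if n is n'.+1 then
    burn n' v + [&& v \in T, burn n' v < w v &
      (v == r) || [exists u in T, (burn n' u == w u) && adj u v]]
  else 0.

Definition lit n v : bool := (v == r) || [exists u in T, (burn n u == w u) && adj u v].
Definition burned n : {set V} := [set v in T | burn n v == w v].
Definition burning n : {set V} := [set v in T | (burn n v < w v) && lit n v].

Lemma burnS n v : burn n.+1 v = burn n v + (v \in burning n).
Proof. by rewrite /= inE. Qed.

Lemma burn_le n v : burn n v <= w v.
Proof.
elim: n => [|n IH] //; rewrite burnS inE.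
have [h|h] := ltnP (burn n v) (w v); last by rewrite andbF addn0.
by apply: leq_trans h; rewrite -addn1 leq_add2l leq_b1.
Qed.

Lemma burned_stable n u : burn n u = w u -> burn n.+1 u = w u.
Proof. by move=> h; rewrite burnS inE h ltnn andbF addn0. Qed.

Lemma lit_stable n v : lit n v -> lit n.+1 v.
Proof.
case/orP => [h|/existsP[u /andP[uT /andP[/eqP bu au]]]]; first by rewrite /lit h.
by apply/orP; right; apply/existsP; exists u; rewrite uT au burned_stable ?eqxx.
Qed.

Lemma burn_lit n v : 0 < burn n v -> v \in T /\ lit n v.
Proof.
elim: n => [|n IH] //; rewrite burnS.
have [|vb] := boolP (v \in burning n).
  by rewrite inE => /and3P[vT _ l] _; split => //; exact: lit_stable.
by rewrite addn0 => /IH [vT l]; split => //; exact: lit_stable.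
Qed.

Lemma weight_rcons x p y : weight (x :: rcons p y) = weight (x :: p) + w y.
Proof. by rewrite /weight -rcons_cons -cats1 big_cat big_seq1. Qed.

(** Induction on time. When [v] catches fire, it is [r] itself or has a neighbour in [T] that is
    burned down, whose route is prolonged by [v]. The [n] steps pay for the weight of the route
    except for the unburned rest [w v - burn n v] of its last vertex. *)
Lemma burn_route n v : 0 < burn n v ->
  exists2 p, route S r v p & weight (r :: p) + burn n v <= n + w v.
Proof.
elim: n v => [|n IH] v //; rewrite burnS.
have [b0|] := posnP (burn n v); last first.
  by move/IH => [p rp wp] _; exists p => //; case: (_ \in _); lia.
rewrite b0 add0n lt0b => vb; rewrite vb.
have rS : r \in S by apply: (subsetP TS).
move: vb; rewrite inE b0 w0 /= => /andP[vT /orP[/eqP ->|]].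
  by exists [::]; rewrite /route /= ?eqxx ?rS // /weight big_seq1; lia.
case/existsP => u /andP[uT /andP[/eqP bu au]].
have [|p /and3P[pp /eqP lp Sp] wp] := IH u; first by rewrite bu.
exists (rcons p v); last by rewrite weight_rcons; lia.
rewrite /route rcons_path pp lp au last_rcons eqxx /= all_rcons.
by move: Sp => /= /andP[-> ->]; rewrite (subsetP TS).
Qed.

Definition volume n : nat := \sum_(v in T) burn n v.

Lemma volumeS n : volume n.+1 = volume n + #|burning n|.
Proof.
rewrite /volume; under eq_bigr => v _ do rewrite burnS.
rewrite big_split /= -sum1_card; congr (_ + _).
rewrite big_mkcond [RHS]big_mkcond /=; apply: eq_bigr => v _.
by rewrite inE; case: (v \in T) => //=; case: (_ && _).
Qed.

Lemma volume_le n : volume n <= \sum_(v in burned n :|: burning n) w v.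
Proof.
rewrite /volume [X in _ <= X]big_mkcond [X in X <= _]big_mkcond /=; apply: leq_sum => v _.
rewrite !inE; case vT: (v \in T) => //=.
have [->|b0] := posnP (burn n v); first by case: ifP.
have [_ ->] := burn_lit b0; rewrite andbT.
by have l := burn_le n v; rewrite -leq_eqVlt l.
Qed.

Lemma volume_total n : volume n <= \sum_(v in T) w v.
Proof. by apply: leq_sum => v _; exact: burn_le. Qed.

Lemma burning_boundary n u v : u \in burned n -> v \in T -> adj u v ->
  v \in burned n :|: burning n.
Proof.
rewrite !inE => /andP[uT bu] vT au; rewrite vT /=.
have l : lit n v by apply/orP; right; apply/existsP; exists u; rewrite uT bu.
by rewrite l andbT -leq_eqVlt burn_le.
Qed.

Lemma source_touched n : r \in burned n :|: burning n.
Proof. by rewrite !inE rT /= /lit eqxx /= andbT -leq_eqVlt burn_le. Qed.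

(* If [h * m * #|burning n|] exceeded [Z + h * volume n] throughout, the latter
   would double every [m] steps. *)
Lemma slow_burning (h m q Z : nat) : 0 < Z -> h * (\sum_(v in T) w v) + Z < 2 ^ q * Z ->
  exists2 n, n <= m * q & h * m * #|burning n| <= Z + h * volume n.
Proof.
clear w0 TS rT; move=> Z0 big.
have [/existsP[n hn]|/existsPn no] := boolP [exists n : 'I_(m * q).+1,
  h * m * #|burning n| <= Z + h * volume n].
  by exists n => //; rewrite -ltnS.
have grow n : n <= m * q -> Z + h * volume n < h * m * #|burning n|.
  by move=> nq; have := no (Ordinal (nq : n < (m * q).+1)); rewrite -ltnNge.
have mono n k : volume n <= volume (n + k).
  by elim: k => [|k IH]; rewrite ?addn0 // addnS volumeS (leq_trans IH) ?leq_addr.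
have add n k : n + k <= m * q -> m * (Z + h * volume n) + k * (Z + h * volume n) <=
    m * (Z + h * volume (n + k)).
  elim: k => [|k IH] nk; first by rewrite mul0n !addn0.
  have nk' : n + k <= m * q by lia.
  have := IH nk'; have := grow _ nk'.
  have h1 : h * volume n <= h * volume (n + k) by rewrite leq_mul2l mono orbT.
  rewrite addnS volumeS.
  have -> : m * (Z + h * (volume (n + k) + #|burning (n + k)|)) =
    m * (Z + h * volume (n + k)) + h * m * #|burning (n + k)| by lia.
  rewrite mulSn.
  move: h1 (k * _) (m * (Z + h * volume n)) (m * (Z + h * volume (n + k))) (h * m * _).
  by move: (h * volume n) (h * volume (n + k)) => x1 x2 h1 x3 x4 x5 x6; lia.
have m0 : 0 < m.
  by case: (m) (grow 0 (leq0n _)) => //; rewrite muln0 mul0n.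
have double j : j <= q -> 2 ^ j * Z <= Z + h * volume (m * j).
  elim: j => [|j IH] jq; first by rewrite mul1n leq_addr.
  have := IH (ltnW jq); have := @add (m * j) m.
  rewrite -mulnSr leq_mul2l jq orbT -mulnDr leq_pmul2l // => /(_ isT).
  by rewrite expnS -mulnA; move: (2 ^ j * Z) => x; lia.
have := double q (leqnn q).
have : h * volume (m * q) <= h * \sum_(v in T) w v by rewrite leq_mul2l volume_total orbT.
by move: big; move: (2 ^ q * Z) (h * _) (h * _) => x1 x2 x3; lia.
Qed.

Lemma burned_route n v : v \in burned n -> exists2 p, route S r v p & weight (r :: p) <= n.
Proof.
rewrite inE => /andP[vT /eqP bv].
have [|p rp wp] := @burn_route n v; first by rewrite bv.
by exists p => //; lia.
Qed.

End Burning.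

(** * Clusters of small radius *)

Section Cluster.
Variables (V : finType) (adj : rel V) (S : {set V}) (w : V -> nat).
Hypothesis w0 : forall v, 0 < w v.

(** [C] is burned and [N] burning at a slow moment of a fire started at [r] within [T]. The total
    weight of [S] serves as the constant [Z] of [slow_burning], so that [q] doublings suffice. *)
Lemma region (T : {set V}) (r : V) (m q : nat) : T \subset S -> r \in T -> #|S|.+1 < 2 ^ q ->
  exists C N : {set V}, [/\ C \subset T, N \subset T, [disjoint C & N] & r \in C :|: N] /\
    [/\ forall u v, u \in C -> v \in T -> adj u v -> v \in C :|: N,
        #|S| * m * #|N| <= \sum_(v in S) w v + #|S| * \sum_(v in C :|: N) w v &
        forall v, v \in C -> exists2 p, route adj S r v p & weight w (r :: p) <= m * q].
Proof.
move=> TS rT hq; have rS := subsetP TS _ rT.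
have W0 : 0 < \sum_(v in S) w v by rewrite (bigD1 r) //= (leq_trans (w0 r)) ?leq_addr.
have WT : \sum_(v in T) w v <= \sum_(v in S) w v.
  by rewrite [X in _ <= X](big_setID T) /= (setIidPr TS) leq_addr.
have [|n nq hn] := @slow_burning V adj T w r #|S| m q _ W0.
  apply: leq_ltn_trans (_ : #|S|.+1 * \sum_(v in S) w v < _); last by rewrite ltn_pmul2r.
  by rewrite mulSn addnC leq_add2l leq_mul2l WT orbT.
exists (burned adj T w r n), (burning adj T w r n); split; split.
- by apply/subsetP => v; rewrite inE => /andP[].
- by apply/subsetP => v; rewrite inE => /andP[].
- rewrite -setI_eq0; apply/eqP/setP => v; rewrite !inE.
  by case: ltngtP; rewrite ?andbF.
- exact: source_touched.
- move=> u v; exact: burning_boundary.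
- by apply: leq_trans hn _; rewrite leq_add2l leq_mul2l volume_le orbT.
- move=> v /(burned_route w0 TS rT) [p rp wp]; exists p => //; exact: leq_trans wp nq.
Qed.

Variable b : nat.
Hypothesis b2 : 1 < b.
Hypothesis expands : forall A K : {set V}, A != set0 -> A \subset S -> K \subset S ->
  [disjoint A & K] -> (forall u v, u \in A -> v \in S -> adj u v -> v \in A :|: K) ->
  2 * #|A :|: K| <= #|S| -> #|A| <= b * #|K|.

(** Regions are cut out of [S] one after the other; [A] collects their burned parts, [K] their rims.
    If none of them had an eighth of the vertices, then [A], on first reaching a quarter, would
    still be below three eighths and [K] below one eighth, so that expansion would apply to [A]. But
    the rims are too thin for [#|A| <= b * #|K|]. *)
Lemma cluster (m q : nat) : S != set0 -> #|S|.+1 < 2 ^ q ->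
  8 * b * (\sum_(v in S) w v) < m * #|S| ->
  exists (C : {set V}) (r : V), [/\ C \subset S, #|S| <= 8 * #|C| &
    forall v, v \in C -> exists2 p, route adj S r v p & weight w (r :: p) <= m * q].
Proof.
move=> S0 hq hm; set W := \sum_(v in S) w v in hm *; set h := #|S| in hm *.
have h0 : 0 < h by rewrite card_gt0.
pose good_set (C : {set V}) (r : V) := [/\ C \subset S, h <= 8 * #|C| &
    forall v, v \in C -> exists2 p, route adj S r v p & weight w (r :: p) <= m * q].
(* The rim estimate of each region costs one extra [W]; the regions are disjoint and each contains
   its own source, so [#|A :|: K|] bounds their number. *)
pose inv (A K : {set V}) := [/\ A \subset S, K \subset S, [disjoint A & K],
  forall u v, u \in A -> v \in S -> adj u v -> v \in A :|: K &
  h * m * #|K| <= #|A :|: K| * W + h * \sum_(v in A :|: K) w v].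
have K_le A K : inv A K -> m * #|K| <= 2 * W.
  case=> AS KS _ _ hK; rewrite -(leq_pmul2l h0) mulnA (leq_trans hK) //.
  have AKS : A :|: K \subset S by rewrite subUset AS.
  have c1 := subset_leq_card AKS.
  have c2 : \sum_(v in A :|: K) w v <= W.
    by rewrite /W [X in _ <= X](big_setID (A :|: K)) /= (setIidPr AKS) leq_addr.
  by rewrite mul2n -addnn mulnDr leq_add // ?leq_mul2r ?c1 ?orbT // leq_mul2l c2 orbT.
have K_small A K : inv A K -> 8 * #|K| < h.
  move=> /K_le hK; have m0 : 0 < m by case: (m) hm.
  rewrite -(ltn_pmul2l m0); apply: leq_ltn_trans hm.
  apply: leq_trans (_ : 8 * (2 * W) <= _); first by rewrite mulnCA leq_mul2l hK.
  by rewrite -mulnA leq_mul2l /= leq_mul2r b2 orbT.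
suff loop n A K : #|S :\: (A :|: K)| <= n -> inv A K -> 4 * #|A| < h ->
    exists C r, good_set C r.
  apply: (loop #|S| set0 set0); rewrite ?setU0 ?setD0 ?cards0 ?muln0 //.
  by split; rewrite ?sub0set ?disjoints_subset ?sub0set ?setU0 ?cards0 ?muln0 // => u v; rewrite inE.
elim: n A K => [|n IH] A K hn ivAK A4.
  have [AS KS AK _ _] := ivAK; have Ks := K_small _ _ ivAK.
  have : #|S| <= #|A :|: K| by apply: subset_leq_card; rewrite -setD_eq0 -cards_eq0; lia.
  have : #|A :|: K| <= #|A| + #|K| by exact: leq_card_setU.
  by rewrite -/h; lia.
have [AS KS AK sep hK] := ivAK; have Ks := K_small _ _ ivAK.
have [r rT] : exists r, r \in S :\: (A :|: K).
  apply/set0Pn; rewrite setD_eq0; apply/negP => /subset_leq_card.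
  have : #|A :|: K| <= #|A| + #|K| by exact: leq_card_setU.
  by rewrite -/h; lia.
have [C [N [[CT NT CN rCN] [sepC hN routeC]]]] := region m (subsetDl S (A :|: K)) rT hq.
have CS : C \subset S by apply: subset_trans CT (subsetDl _ _).
have NS : N \subset S by apply: subset_trans NT (subsetDl _ _).
have [big|small] := leqP h (8 * #|C|); first by exists C, r.
pose A' := A :|: C; pose K' := K :|: N.
have UE : A' :|: K' = (A :|: K) :|: (C :|: N) by rewrite /A' /K' setUACA.
have dis1 : [disjoint A :|: K & C :|: N].
  rewrite disjoint_sym disjoints_subset subUset.
  by move: CT NT; rewrite !setDE !subsetI => /andP[_ ->] /andP[_ ->].
have cU : #|A' :|: K'| = #|A :|: K| + #|C :|: N|.
  by rewrite UE cardsU disjoint_setI0 // cards0 subn0.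
have sU : \sum_(v in A' :|: K') w v = \sum_(v in A :|: K) w v + \sum_(v in C :|: N) w v.
  by rewrite UE -bigU //=; apply: eq_bigl => v; rewrite in_setU [in RHS]inE.
have inv' : inv A' K'.
  split; rewrite ?subUset ?AS ?KS //.
  - rewrite -setI_eq0; apply/eqP/setP => v; rewrite /A' /K' in_set0 !in_setI !in_setU.
    have := @disjointFr _ _ _ v AK; have := @disjointFr _ _ _ v CN.
    have := @disjointFr _ _ _ v dis1; rewrite !in_setU.
    case: (v \in A); case: (v \in K); case: (v \in C); case: (v \in N) => //= h1 h2 h3;
    first [by have := h1 isT | by have := h2 isT | by have := h3 isT].
  - move=> u v uA' vS auv; rewrite UE in_setU.
    have [//|nv] := boolP (v \in A :|: K).
    move: uA'; rewrite {1}/A' in_setU => /orP[uA|uC]; first by rewrite (sep u) in nv.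
    by apply: (sepC u); rewrite // in_setD nv.
  - rewrite cU sU mulnDr mulnDl.
    apply: leq_trans (_ : h * m * (#|K| + #|N|) <= _).
      by rewrite leq_mul2l (leq_of_leqif (leq_card_setU K N)) orbT.
    rewrite mulnDr; apply: leq_trans (leq_add hK hN) _.
    have : 1 * W <= #|C :|: N| * W.
      by rewrite leq_mul2r; apply/orP; right; rewrite card_gt0; apply/set0Pn; exists r.
    by rewrite mul1n addnACA => hW; rewrite leq_add2r leq_add2l.
have [A'4|A'4] := ltnP (4 * #|A'|) h.
  apply: (IH A' K') => //; rewrite -ltnS; apply: leq_trans hn.
  apply: proper_card; apply/properP; split; first by rewrite UE setDS // subsetUl.
  by exists r => //; rewrite in_setD UE in_setU rCN orbT.
have := K_small _ _ inv'; have := K_le _ _ inv' => K'W K's.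
have A'0 : A' != set0 by rewrite -card_gt0; clear -A'4 h0; lia.
have A'c : #|A'| <= #|A| + #|C| by exact: leq_card_setU.
have AKc : #|A' :|: K'| <= #|A'| + #|K'| by exact: leq_card_setU.
have [A'S K'S A'K' sep' _] := inv'.
have := expands A'0 A'S K'S A'K' sep'; rewrite -/h => /(_ _) E.
have {}E : #|A'| <= b * #|K'| by apply: E; clear -A4 small K's A'c AKc; lia.
suff : m * h <= 8 * b * W by rewrite leqNgt hm.
apply: leq_trans (_ : m * (4 * (b * #|K'|)) <= _).
  by rewrite leq_mul2l (leq_trans A'4) ?orbT // leq_mul2l E orbT.
have -> : m * (4 * (b * #|K'|)) = 4 * b * (m * #|K'|) by clear; lia.
have -> : 8 * b * W = 4 * b * (2 * W) by clear; lia.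
by rewrite leq_mul2l K'W orbT.
Qed.
End Cluster.

(** * Routing with a small square sum of loads *)

Lemma sum_sqr_le (T : finType) (A : {set T}) (a : T -> nat) :
  (\sum_(i in A) a i) ^ 2 <= #|A| * \sum_(i in A) a i ^ 2.
Proof.
rewrite -(leq_pmul2l (isT : 0 < 2)).
have -> : 2 * (\sum_(i in A) a i) ^ 2 = \sum_(i in A) \sum_(j in A) 2 * (a i * a j).
  rewrite -mulnn big_distrlr /= big_distrr /=; apply: eq_bigr => i _.
  by rewrite big_distrr.
have -> : 2 * (#|A| * \sum_(i in A) a i ^ 2) = \sum_(i in A) \sum_(j in A) (a i ^ 2 + a j ^ 2).
  transitivity (\sum_(i in A) (#|A| * a i ^ 2 + \sum_(j in A) a j ^ 2)).
    by rewrite big_split /= sum_nat_const -big_distrr /= addnn mul2n.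
  by apply: eq_bigr => i _; rewrite big_split /= sum_nat_const.
by apply: leq_sum => i _; apply: leq_sum => j _; exact: nat_Cauchy.
Qed.

Section Routing.
Variables (V : finType) (adj : rel V) (S : {set V}).
Hypothesis adjC : symmetric adj.

Definition routed (d : V * V) (s : seq V) : bool :=
  if s is x :: p then [&& x == d.1, route adj S x d.2 p & uniq s] else false.

Lemma weight_uniq (w : V -> nat) (s t : seq V) : uniq s -> {subset s <= t} ->
  weight w s <= weight w t.
Proof.
move=> us st; rewrite /weight big_uniq //=.
apply: leq_trans (_ : \sum_(v <- undup t) w v <= _).
  rewrite big_uniq ?undup_uniq //= [X in X <= _]big_mkcond [X in _ <= X]big_mkcond /=.
  apply: leq_sum => v _; rewrite mem_undup; case: ifP => // vs; by rewrite st.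
elim: {st} t => [|x t IH] //=; case: ifP => _; rewrite !big_cons ?leq_add2l //.
by apply: leq_trans IH _; exact: leq_addl.
Qed.

(** The reversal of the first route followed by the second leads from [x] to [y] through [r];
    cutting out loops makes it simple and only drops weight. *)
Lemma route_join (w : V -> nat) r x y p1 p2 : route adj S r x p1 -> route adj S r y p2 ->
  exists2 s, routed (x, y) s & weight w s <= weight w (r :: p1) + weight w (r :: p2).
Proof.
case/and3P => pp1 /eqP lp1 Sp1 /and3P[pp2 /eqP lp2 Sp2].
pose q := rev (belast r p1).
have xq : x :: q = rev (r :: p1) by rewrite [r :: p1]lastI rev_rcons lp1.
have pq : path adj x q.
  by rewrite -lp1 /q rev_path; apply: sub_path pp1 => a b; rewrite /= adjC.
have lq : last x q = r.
  have : last x (x :: q) = r by rewrite xq rev_cons last_rcons.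
  by [].
have pxy : path adj x (q ++ p2) by rewrite cat_path pq lq.
have lxy : last x (q ++ p2) = y by rewrite last_cat lq.
have sq : {subset x :: q ++ p2 <= (r :: p1) ++ (r :: p2)}.
  move=> v; rewrite -cat_cons xq !mem_cat mem_rev => /orP[-> //|vp].
  by rewrite [v \in r :: p2]in_cons vp !orbT.
have allS : all (fun v => v \in S) ((r :: p1) ++ (r :: p2)) by rewrite all_cat Sp1 Sp2.
case: (shortenP pxy) lxy => p pp up sp lp.
have sub : {subset x :: p <= (r :: p1) ++ (r :: p2)}.
  move=> v; rewrite in_cons => /orP[/eqP ->|vp]; apply: sq; first exact: mem_head.
  by rewrite in_cons sp ?orbT.
exists (x :: p).
  by rewrite /routed eqxx up /route pp lp eqxx !andTb andbT; apply/allP => v /sub /(allP allS).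
apply: leq_trans (weight_uniq w up sub) _.
by rewrite /weight big_cat.
Qed.

Variable chi : V -> bool.
Let h := #|S|.
Let k := trunc_log 2 h.
Hypothesis S0 : S != set0.
Hypothesis expands : forall A K : {set V}, A != set0 -> A \subset S -> K \subset S ->
  [disjoint A & K] -> (forall u v, u \in A -> v \in S -> adj u v -> v \in A :|: K) ->
  2 * #|A :|: K| <= #|S| -> #|A| <= 2 * k.+1 ^ 2 * #|K|.

Definition monochromatic (U : {set V}) := forall u v, u \in U -> v \in U -> chi u = chi v.

(** [U] is the larger colour class of a cluster, and any two of its vertices are joined through the
    source of the cluster. *)
Lemma cheap_clique (w : V -> nat) : (forall v, 0 < w v) ->
  exists U : {set V}, [/\ U \subset S, monochromatic U, h <= 16 * #|U| &
    forall x y, x \in U -> y \in U -> exists2 s, routed (x, y) s &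
      h * weight w s <= 34 * k.+2 ^ 3 * \sum_(v in S) w v].
Proof.
move=> w0; set W := \sum_(v in S) w v.
have h0 : 0 < h by rewrite card_gt0.
have hW : h <= W by rewrite /h -sum1_card; apply: leq_sum.
(* [b] is the expansion factor, and [m] the least radius scale that [cluster] admits. *)
pose b := 2 * k.+1 ^ 2; pose m := (8 * b * W) %/ h + 1.
have b2 : 1 < b.
  have : 0 < k.+1 ^ 2 by rewrite expn_gt0.
  by rewrite /b; move: (k.+1 ^ 2) => z; lia.
have hk : h.+1 < 2 ^ k.+2.
  have hk1 : h < 2 ^ k.+1 by exact: trunc_log_ltn.
  by rewrite expnS; move: (2 ^ k.+1) hk1 h0 => z; lia.
have hm : 8 * b * W < m * h by rewrite /m addn1 ltn_ceil.
have [C [r [CS hC rC]]] := cluster w0 b2 expands S0 hk hm.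
have [U [US UC mU hU]] : exists U : {set V},
    [/\ U \subset S, U \subset C, monochromatic U & #|C| <= 2 * #|U|].
  have cC := cardsID [set v | chi v] C.
  have [le|lt] := leqP #|C :\: [set v | chi v]| #|C :&: [set v | chi v]|.
    exists (C :&: [set v | chi v]); split; last by lia.
    - by apply: subset_trans CS; exact: subsetIl.
    - exact: subsetIl.
    - by move=> u v; rewrite !inE => /andP[_ ->] /andP[_ ->].
  exists (C :\: [set v | chi v]); split; last by lia.
  - by apply: subset_trans CS; exact: subsetDl.
  - exact: subsetDl.
  - by move=> u v; rewrite !inE => /andP[/negbTE -> _] /andP[/negbTE -> _].
exists U; split => //; first by move: hC; rewrite -/h; lia.
move=> x y /(subsetP UC) /rC [p1 r1 w1] /(subsetP UC) /rC [p2 r2 w2].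
have [s rs ws] := route_join w r1 r2; exists s => //.
apply: leq_trans (_ : h * (2 * (m * k.+2)) <= _).
  rewrite leq_mul2l; apply/orP; right; apply: leq_trans ws _.
  by rewrite mul2n -addnn leq_add.
have mh : m * h <= (8 * b).+1 * W.
  by rewrite /m mulnDl mul1n mulSn addnC leq_add // leq_trunc_div.
apply: leq_trans (_ : 2 * k.+2 * ((8 * b).+1 * W) <= _).
  have -> : h * (2 * (m * k.+2)) = 2 * k.+2 * (m * h) by clear; lia.
  by rewrite leq_mul2l mh orbT.
rewrite mulnA leq_mul2r; apply/orP; right.
(* The constant arises from [8 * b + 1 = 16 * k.+1 ^ 2 + 1 <= 17 * k.+2 ^ 2], doubled because a path
   consists of two routes. *)
have -> : 34 * k.+2 ^ 3 = 2 * k.+2 * (17 * k.+2 ^ 2) by rewrite (expnS _ 2); clear; lia.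
rewrite leq_mul2l; apply/orP; right.
have : k.+1 ^ 2 <= k.+2 ^ 2 by rewrite leq_exp2r.
have : 0 < k.+2 ^ 2 by rewrite expn_gt0.
by rewrite /b; move: (k.+1 ^ 2) (k.+2 ^ 2) => x1 x2; clear; lia.
Qed.

Definition load (D : {set V * V}) (pi : V * V -> seq V) (v : V) : nat :=
  #|[set d in D | v \in pi d]|.
(** With the shift by one the empty routing has potential [#|S|]. *)
Definition potential D pi : nat := \sum_(v in S) (load D pi v).+1 ^ 2.

Definition routing (D : {set V * V}) (pi : V * V -> seq V) : Prop :=
  D \subset setX S S /\ forall d, d \in D -> routed d (pi d).

(** A simple path raises each load [l] on it exactly once, and
    [(l + 2) ^ 2 - (l + 1) ^ 2 = 2 * l + 3]. *)
Lemma potential_add (D : {set V * V}) pi d s : d \notin D -> uniq s -> all (fun v => v \in S) s ->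
  let pi' d' := if d' == d then s else pi d' in
  potential (d |: D) pi' = potential D pi + weight (fun v => 2 * load D pi v + 3) s.
Proof.
move=> dD us sS pi'.
have ld v : load (d |: D) pi' v = load D pi v + (v \in s).
  rewrite /load; have -> : [set d' in d |: D | v \in pi' d'] =
    [set d' in [set d] | v \in s] :|: [set d' in D | v \in pi d'].
    apply/setP => d'; rewrite !inE /pi'; have [->|ne] //= := eqVneq d' d.
    by rewrite (negbTE dD) /= orbF.
  rewrite cardsU disjoint_setI0 ?cards0 ?subn0; last first.
    rewrite disjoints_subset; apply/subsetP => d'; rewrite !inE => /andP[/eqP -> _].
    by rewrite (negbTE dD).
  rewrite addnC; congr (_ + _); case: (v \in s).
    by rewrite -[RHS](cards1 d); apply: eq_card => d'; rewrite !inE andbT.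
  by rewrite -[RHS](cards0 (V * V)%type); apply: eq_card => d'; rewrite !inE andbF.
rewrite /potential /weight big_uniq //=.
have -> : \sum_(v in s) (2 * load D pi v + 3) = \sum_(v in S) (v \in s) * (2 * load D pi v + 3).
  rewrite [LHS]big_mkcond [RHS]big_mkcond /=; apply: eq_bigr => v _.
  case vs: (v \in s); last by case: ifP; rewrite ?mul0n.
  by rewrite (allP sS v vs) mul1n.
rewrite -big_split /=; apply: eq_bigr => v _; rewrite ld.
by case: (v \in s); rewrite /= ?addn0 ?mul0n ?mul1n //; move: (load D pi v) => x; rewrite -!mulnn; lia.
Qed.

(** Greedy routing: as long as the cheap clique for the weights [2 * load + 3] has an unrouted pair,
    that pair is routed. There are at most [h ^ 2] pairs, so at some point all pairs of the current
    clique are routed. *)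
Lemma routed_clique : let L := 34 * k.+2 ^ 3 in
  exists (U : {set V}) (D : {set V * V}) (pi : V * V -> seq V),
  [/\ U \subset S, monochromatic U & h <= 16 * #|U|] /\
  [/\ routing D pi, forall x y, x \in U -> y \in U -> (x, y) \in D &
      potential D pi <= 9 * L ^ 2 * h ^ 3].
Proof.
move=> L; have h0 : 0 < h by rewrite card_gt0.
have L0 : 0 < L by rewrite muln_gt0 expn_gt0.
(* By Cauchy-Schwarz the square root of [h * potential] grows by at most [2 * L] with each
   new path, as the latter is cheap for the weights [2 * load + 3]. *)
pose bounded (D : {set V * V}) pi := h * potential D pi <= (h + 2 * L * #|D|) ^ 2.
have D_le (D : {set V * V}) pi : routing D pi -> #|D| <= h ^ 2.
  by case=> /subset_leq_card + _; rewrite cardsX mulnn.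
(* With at most [h ^ 2] paths the square root of [h * potential] is at most
   [h + 2 * L * h ^ 2 <= 3 * L * h ^ 2]. *)
have final D pi : routing D pi -> bounded D pi -> potential D pi <= 9 * L ^ 2 * h ^ 3.
  move=> rD PD; rewrite -(leq_pmul2l h0) (leq_trans PD) //.
  have -> : h * (9 * L ^ 2 * h ^ 3) = (3 * L * h ^ 2) ^ 2.
    by rewrite (expnS h 2) -!mulnn; clear; lia.
  rewrite leq_exp2r //.
  have h2 : h <= L * h ^ 2 by rewrite -mulnn mulnA leq_pmull // muln_gt0 L0.
  have := D_le _ _ rD; rewrite -(leq_pmul2l L0) => LD.
  by rewrite -!mulnA; clear -h2 LD; lia.
have step (D : {set V * V}) pi : routing D pi -> bounded D pi ->
    (exists U : {set V}, [/\ U \subset S, monochromatic U, h <= 16 * #|U| &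
       forall x y, x \in U -> y \in U -> (x, y) \in D]) \/
    (exists D' pi', [/\ routing D' pi', bounded D' pi' & #|D'| = #|D|.+1]).
  move=> rD PD; have [DS piD] := rD.
  have [|U [US mU hU rU]] := @cheap_clique (fun v => 2 * load D pi v + 3).
    by move=> v; rewrite addn3.
  have [/forallP allU|] := boolP [forall d : V * V, (d.1 \in U) && (d.2 \in U) ==> (d \in D)].
    by left; exists U; split => // x y xU yU; have := allU (x, y); rewrite /= xU yU.
  rewrite negb_forall => /existsP[[x y]]; rewrite negb_imply /= => /andP[/andP[xU yU] dD].
  have [s rs ws] := rU x y xU yU.
  have sS : all (fun v => v \in S) s by case: (s) rs => [|z p] //= /and3P[_ /and3P[]].
  have us : uniq s by case: (s) rs => [|z p] //= /and3P[].
  have := potential_add pi dD us sS; set pi' := fun d' => _ => /= PA.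
  have cD : #|(x, y) |: D| = #|D|.+1 by rewrite cardsU1 dD.
  right; exists ((x, y) |: D), pi'; split => //.
    split; first by rewrite subUset DS andbT sub1set in_setX (subsetP US x xU) (subsetP US y yU).
    move=> d; rewrite in_setU1 /pi'; have [-> //|ne /=] := eqVneq d (x, y); exact: piD.
  rewrite /bounded cD PA mulnDr; rewrite /bounded in PD; set X := h + 2 * L * #|D| in PD.
  have -> : h + 2 * L * #|D|.+1 = X + 2 * L by rewrite /X mulnS; clear; lia.
  (* Cauchy-Schwarz bounds [Y] by the square root of [h * potential], hence by [X]; the total weight
     is at most [3 * Y]. *)
  pose Y := \sum_(v in S) (load D pi v).+1.
  have YX : Y <= X.
    by rewrite -(@leq_exp2r Y X 2) // (leq_trans _ PD) // sum_sqr_le.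
  have WY : \sum_(v in S) (2 * load D pi v + 3) <= 3 * X.
    apply: leq_trans (_ : 3 * Y <= _); last by rewrite leq_mul2l.
    by rewrite /Y big_distrr /=; apply: leq_sum => v _; clear; lia.
  have wX : h * weight (fun v => 2 * load D pi v + 3) s <= L * (3 * X).
    by apply: leq_trans ws _; rewrite leq_mul2l WY orbT.
  apply: leq_trans (leq_add PD wX) _.
  have -> : (X + 2 * L) ^ 2 = X ^ 2 + (2 * L) ^ 2 + 2 * (X * (2 * L)) by rewrite sqrnD.
  by rewrite -addnA leq_add2l; clear; lia.
suff loop n (D : {set V * V}) pi : routing D pi -> bounded D pi -> h ^ 2 < n + #|D| ->
    exists (U : {set V}) (D : {set V * V}) (pi : V * V -> seq V),
  [/\ U \subset S, monochromatic U & h <= 16 * #|U|] /\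
  [/\ routing D pi, forall x y, x \in U -> y \in U -> (x, y) \in D &
      potential D pi <= 9 * L ^ 2 * h ^ 3].
  apply: (loop (h ^ 2).+1 set0 (fun=> [::])); last by rewrite addSn ltnS leq_addr.
    by split; [rewrite sub0set|move=> d; rewrite inE].
  rewrite /bounded cards0 muln0 addn0 -mulnn leq_mul2l /potential; apply/orP; right.
  rewrite /h -sum1_card leq_sum // => v _; rewrite /load.
  by rewrite (_ : [set d in _ | _] = set0) ?cards0 //; apply/setP => d; rewrite !inE.
elim: n D pi => [|n IH] D pi rD PD Dn.
  by have := leq_trans Dn (D_le _ _ rD); rewrite ltnn.
have [[U [US mU hU allU]]|[D' [pi' [rD' PD' cD]]]] := step D pi rD PD.
  by exists U, D, pi; split; split => //; exact: final.
by apply: (IH D' pi') => //; rewrite cD addnS.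
Qed.
End Routing.

(** The field with two elements, registered below so that [ring] proves parity identities. *)
Lemma bool_ring_theory : ring_theory false true addb andb addb id (@eq bool).
Proof. by constructor; do ?case. Qed.

Lemma bool_eqb_eq (a b : bool) : eqb a b = true -> a = b.
Proof. exact: eqP. Qed.

Ltac bool_constant t :=
  match t with true => constr:(true) | false => constr:(false) | _ => constr:(NotConstant) end.

Add Ring bool_ring : bool_ring_theory (decidable bool_eqb_eq, constants [bool_constant]).

(** * Crossing parity of two paths *)

Section Parity.
Variables (V : finType) (adj : rel V) (D : rel {set V}).
Variables (x : {set V} -> V -> bool) (B : rel V) (chi : V -> bool).

Definition steps (u : V) (p : seq V) : seq {set V} := pairmap (fun a b => [set a; b]) u p.

Definition crossing_formula (u w a b : V) : bool :=
  x [set u; w] a (+) x [set u; w] b (+) (x [set a; b] u (+) x [set a; b] w)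
  (+) (B u a (+) B u b (+) (B w a (+) B w b)).

Hypothesis B_tournament : forall u v, u != v -> B u v = ~~ B v u.
Hypothesis adj_chi : forall u v, adj u v -> chi u != chi v.
Hypothesis non_disjoint_cross : forall u w a b, adj u w -> adj a b ->
  [disjoint [set u; w] & [set a; b]] -> ~~ D [set u; w] [set a; b] -> crossing_formula u w a b.

Definition path_sum (p : V * seq V) (v : V) : bool :=
  \big[addb/false]_(e <- steps p.1 p.2) x e v.

Lemma path_sum_cons u y p v : path_sum (u, y :: p) v = x [set u; y] v (+) path_sum (y, p) v.
Proof. by rewrite /path_sum /= big_cons. Qed.

Lemma path_chi u p : path adj u p -> chi (last u p) = chi u (+) odd (size p).
Proof.
elim: p u => [|y p IH] u /=; first by rewrite addbF.
by case/andP => /adj_chi uy /IH ->; case: (chi u) uy; case: (chi y) => //=; case: odd.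
Qed.

(** The crossing formula holds for [uw] with each step of [q]. In the sum over the steps the terms
    at inner vertices of [q] occur twice and cancel, and the left side counts the steps. *)
Lemma edge_path_parity u w a q : adj u w -> path adj a q ->
  (forall v, v \in a :: q -> v != u /\ v != w) ->
  (forall f, f \in steps a q -> ~~ D [set u; w] f) ->
  odd (size q) = x [set u; w] a (+) x [set u; w] (last a q)
    (+) (path_sum (a, q) u (+) path_sum (a, q) w)
    (+) (B u a (+) B u (last a q) (+) (B w a (+) B w (last a q))).
Proof.
move=> uw; elim: q a => [|y q IH] a /=.
  by move=> _ _ _; rewrite /path_sum !big_nil; case: x; case: (B u a); case: (B w a).
case/andP => ay pq dis nD.
have := IH y pq (fun v vq => dis v (mem_behead (s := a :: y :: q) vq)).
move=> /(_ (fun f fq => nD f (mem_behead (s := _ :: steps y q) fq))) ->.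
have [au aw] := dis a (mem_head _ _).
have [yu yw] : y != u /\ y != w by apply: dis; rewrite !inE eqxx orbT.
have : crossing_formula u w a y.
  apply: non_disjoint_cross => //; last by apply: nD; exact: mem_head.
  rewrite disjoint_sym disjoints_subset; apply/subsetP => v; rewrite !inE negb_or.
  by case/orP => /eqP ->; rewrite ?au ?aw ?yu ?yw.
rewrite /crossing_formula !path_sum_cons => cr.
by rewrite -addTb -[X in X (+) _]cr; ring.
Qed.

(** The same telescoping along [p]. All pairs of steps satisfy the formula, and their number is
    [size p * size q]. *)
Lemma path_path_parity u p a q : path adj u p -> path adj a q ->
  (forall v, v \in u :: p -> v \notin a :: q) ->
  (forall e f, e \in steps u p -> f \in steps a q -> ~~ D e f) ->
  odd (size p) && odd (size q) = path_sum (u, p) a (+) path_sum (u, p) (last a q)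
    (+) (path_sum (a, q) u (+) path_sum (a, q) (last u p))
    (+) (B u a (+) B u (last a q) (+) (B (last u p) a (+) B (last u p) (last a q))).
Proof.
move=> + pq; elim: p u => [|y p IH] u /=.
  by move=> _ _ _; rewrite /path_sum !big_nil; case: (\big[_/_]_(_ <- _) _); case: (B u a); case: (B u _).
case/andP => uy pp dis nD.
have eq1 := edge_path_parity uy pq.
have {}eq1 : odd (size q) = x [set u; y] a (+) x [set u; y] (last a q)
    (+) (path_sum (a, q) u (+) path_sum (a, q) y)
    (+) (B u a (+) B u (last a q) (+) (B y a (+) B y (last a q))).
  apply: eq1 => [v vq|f fq]; last by apply: nD => //; exact: mem_head.
  split; apply/eqP => E; rewrite -E in dis.
    by have := dis v (mem_head _ _); rewrite vq.
  by have := dis v; rewrite !inE eqxx orbT -in_cons vq => /(_ isT).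
have := IH y pp (fun v vp => dis v (mem_behead (s := u :: y :: p) vp)).
move=> /(_ (fun e f ep fq => nD e f (mem_behead (s := _ :: steps y p) ep) fq)).
rewrite !path_sum_cons => eq2.
have -> : ~~ odd (size p) && odd (size q) = odd (size q) (+) (odd (size p) && odd (size q)).
  by case: odd; case: odd.
by rewrite eq2 eq1; ring.
Qed.

End Parity.

(** * Five vertices joined by ten paths *)

Section K5.

(* Each [X i j k] occurs in two of the fifteen equations. *)
Lemma k5_cancel (X : nat -> nat -> nat -> bool) (b : nat -> nat -> bool) :
  (forall i j, i < j -> j < 5 -> b j i = ~~ b i j) ->
  (forall i j k l, i < j -> k < l -> [&& i != k, i != l, j != k & j != l] ->
     i < 5 -> j < 5 -> k < 5 -> l < 5 ->
     X i j k (+) X i j l (+) (X k l i (+) X k l j) (+)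
     (b i k (+) b i l (+) (b j k (+) b j l)) = false) ->
  False.
Proof.
move=> hb h.
have bC i j : i < j -> j < 5 -> b j i = true (+) b i j by move=> ij j5; rewrite (hb _ _ ij j5).
have e0 := h 0 1 2 3 isT isT isT isT isT isT isT.
have e1 := h 0 1 2 4 isT isT isT isT isT isT isT.
have e2 := h 0 1 3 4 isT isT isT isT isT isT isT.
have e3 := h 0 2 1 3 isT isT isT isT isT isT isT.
have e4 := h 0 2 1 4 isT isT isT isT isT isT isT.
have e5 := h 0 2 3 4 isT isT isT isT isT isT isT.
have e6 := h 0 3 1 2 isT isT isT isT isT isT isT.
have e7 := h 0 3 1 4 isT isT isT isT isT isT isT.
have e8 := h 0 3 2 4 isT isT isT isT isT isT isT.
have e9 := h 0 4 1 2 isT isT isT isT isT isT isT.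
have e10 := h 0 4 1 3 isT isT isT isT isT isT isT.
have e11 := h 0 4 2 3 isT isT isT isT isT isT isT.
have e12 := h 1 2 3 4 isT isT isT isT isT isT isT.
have e13 := h 1 3 2 4 isT isT isT isT isT isT isT.
have e14 := h 1 4 2 3 isT isT isT isT isT isT isT.
have : true = false; last by [].
(* The sum of all fifteen left sides. Each of the ten pairs of indices carries six of the sixty [b]
   terms, which cancel up to orientation; fifteen of them, an odd number, read [b j i] with [i < j]
   and leave [true] behind. *)
transitivity (
  (X 0 1 2 (+) X 0 1 3 (+) (X 2 3 0 (+) X 2 3 1) (+) (b 0 2 (+) b 0 3 (+) (b 1 2 (+) b 1 3))) (+)
  (X 0 1 2 (+) X 0 1 4 (+) (X 2 4 0 (+) X 2 4 1) (+) (b 0 2 (+) b 0 4 (+) (b 1 2 (+) b 1 4))) (+)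
  (X 0 1 3 (+) X 0 1 4 (+) (X 3 4 0 (+) X 3 4 1) (+) (b 0 3 (+) b 0 4 (+) (b 1 3 (+) b 1 4))) (+)
  (X 0 2 1 (+) X 0 2 3 (+) (X 1 3 0 (+) X 1 3 2) (+) (b 0 1 (+) b 0 3 (+) (b 2 1 (+) b 2 3))) (+)
  (X 0 2 1 (+) X 0 2 4 (+) (X 1 4 0 (+) X 1 4 2) (+) (b 0 1 (+) b 0 4 (+) (b 2 1 (+) b 2 4))) (+)
  (X 0 2 3 (+) X 0 2 4 (+) (X 3 4 0 (+) X 3 4 2) (+) (b 0 3 (+) b 0 4 (+) (b 2 3 (+) b 2 4))) (+)
  (X 0 3 1 (+) X 0 3 2 (+) (X 1 2 0 (+) X 1 2 3) (+) (b 0 1 (+) b 0 2 (+) (b 3 1 (+) b 3 2))) (+)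
  (X 0 3 1 (+) X 0 3 4 (+) (X 1 4 0 (+) X 1 4 3) (+) (b 0 1 (+) b 0 4 (+) (b 3 1 (+) b 3 4))) (+)
  (X 0 3 2 (+) X 0 3 4 (+) (X 2 4 0 (+) X 2 4 3) (+) (b 0 2 (+) b 0 4 (+) (b 3 2 (+) b 3 4))) (+)
  (X 0 4 1 (+) X 0 4 2 (+) (X 1 2 0 (+) X 1 2 4) (+) (b 0 1 (+) b 0 2 (+) (b 4 1 (+) b 4 2))) (+)
  (X 0 4 1 (+) X 0 4 3 (+) (X 1 3 0 (+) X 1 3 4) (+) (b 0 1 (+) b 0 3 (+) (b 4 1 (+) b 4 3))) (+)
  (X 0 4 2 (+) X 0 4 3 (+) (X 2 3 0 (+) X 2 3 4) (+) (b 0 2 (+) b 0 3 (+) (b 4 2 (+) b 4 3))) (+)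
  (X 1 2 3 (+) X 1 2 4 (+) (X 3 4 1 (+) X 3 4 2) (+) (b 1 3 (+) b 1 4 (+) (b 2 3 (+) b 2 4))) (+)
  (X 1 3 2 (+) X 1 3 4 (+) (X 2 4 1 (+) X 2 4 3) (+) (b 1 2 (+) b 1 4 (+) (b 3 2 (+) b 3 4))) (+)
  (X 1 4 2 (+) X 1 4 3 (+) (X 2 3 1 (+) X 2 3 4) (+) (b 1 2 (+) b 1 3 (+) (b 4 2 (+) b 4 3)))).
  rewrite ?(bC 0 1 isT isT) ?(bC 0 2 isT isT) ?(bC 0 3 isT isT) ?(bC 0 4 isT isT) ?(bC 1 2 isT isT)
    ?(bC 1 3 isT isT) ?(bC 1 4 isT isT) ?(bC 2 3 isT isT) ?(bC 2 4 isT isT)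
    ?(bC 3 4 isT isT); ring.
by rewrite e0 e1 e2 e3 e4 e5 e6 e7 e8 e9 e10 e11 e12 e13 e14.
Qed.
End K5.

(** * Weighted Kovari-Sos-Turan bound *)

Section WeightedKST.
Variables (T : finType) (D : rel T) (c : T -> nat) (t M La th : nat).
Hypothesis cM : forall e, c e <= M.
Hypothesis cLa : \sum_e c e <= La.
Hypothesis noK : forall A B : {set T}, #|A| = t -> #|B| = t ->
  exists e f, [/\ e \in A, f \in B & ~~ D e f].

Let degree e := \sum_(f | D e f) c f.
(** The slack [t * M] pays for neighbours in a set of at most [t] elements, so that weight [th]
    remains outside of it. *)
Let heavy : {set T} := [set e | th + t * M <= degree e].
Let cw (A : {set T}) := \sum_(e in A) c e.
Let common (F : {set T}) : {set T} := [set e in heavy | [forall f in F, D e f]].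

Lemma cw_le A : cw A <= #|A| * M.
Proof. by rewrite -sum_nat_const; apply: leq_sum. Qed.

Lemma cw_total A : cw A <= La.
Proof. by apply: leq_trans cLa; rewrite [X in _ <= X](bigID (mem A)) /= leq_addr. Qed.

(** Each heavy element has neighbours of weight at least [th] outside [F], out of a total of at most
    [La]. By averaging, some [f] outside [F] keeps a fraction [th / La] of the weight of the common
    neighbourhood. *)
Lemma grow_common i : 0 < cw heavy * th -> i <= t ->
  exists2 F : {set T}, #|F| = i & cw heavy * th ^ i <= cw (common F) * La ^ i.
Proof.
rewrite muln_gt0 => /andP[hv0 th0].
have La0 : 0 < La := leq_trans hv0 (cw_total _).
elim: i => [|i IH] it.
  exists set0; rewrite ?cards0 // !muln1 (_ : common set0 = heavy) //.
  apply/setP => e; rewrite inE; case: (e \in heavy) => //=.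
  by apply/forallP => f; rewrite inE.
have [F cF hF] := IH (ltnW it).
have cF0 : 0 < cw (common F).
  have : 0 < cw heavy * th ^ i by rewrite muln_gt0 hv0 expn_gt0 th0.
  by move/leq_trans => /(_ _ hF); rewrite muln_gt0 => /andP[].
have [/existsP[f /andP[fF hf]]|/existsPn no] := boolP
    [exists f, (f \notin F) && (cw (common F) * th <= cw (common (f |: F)) * La)].
  exists (f |: F); first by rewrite cardsU1 fF cF.
  rewrite !expnSr !mulnA; apply: leq_trans (_ : cw (common F) * La ^ i * th <= _).
    by rewrite leq_mul2r hF orbT.
  by rewrite mulnAC [X in _ <= X]mulnAC leq_mul2r hf orbT.
exfalso.
pose G f := cw (common (f |: F)).
have G_lt f : f \notin F -> G f * La < cw (common F) * th.
  by move=> fF; have := no f; rewrite fF /= -ltnNge.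
have swap : cw (common F) * th <= \sum_(f in ~: F) c f * G f.
  have -> : \sum_(f in ~: F) c f * G f = \sum_(e in common F) c e * \sum_(f in ~: F | D e f) c f.
    transitivity (\sum_(f in ~: F) \sum_(e in common F | D e f) c f * c e).
      apply: eq_bigr => f _; rewrite big_distrr /=; apply: eq_bigl => e.
      rewrite !inE -andbA; congr (_ && _); apply/idP/idP.
        move/forallP => h; have := h f; rewrite setU11 /= => ->; rewrite andbT.
        by apply/forallP => g; apply/implyP => gF; have := h g; rewrite inE gF orbT.
      case/andP => /forallP h df; apply/forallP => g; apply/implyP; rewrite !inE.
      by case/orP => [/eqP ->//|gF]; have := h g; rewrite gF.
    rewrite (exchange_big_dep (mem (common F))) /=; last by move=> f e _ /andP[].
    apply: eq_bigr => e eF; rewrite big_distrr /=.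
    by apply: eq_big => f; [move: eF => /= ->|rewrite mulnC].
  rewrite /cw big_distrl /=; apply: leq_sum => e; rewrite !inE => /andP[he _].
  rewrite leq_mul2l; apply/orP; right.
  rewrite -(leq_add2r (t * M)) (leq_trans he) // /degree (bigID (mem F)) /= addnC leq_add //.
    by rewrite leq_eqVlt; apply/orP; left; apply/eqP; apply: eq_bigl => f; rewrite in_setC andbC.
  apply: leq_trans (_ : \sum_(f in F) c f <= _).
    rewrite [X in X <= _]big_mkcond [X in _ <= X]big_mkcond /=; apply: leq_sum => f _.
    by case: (D e f); case: (f \in F).
  by rewrite (leq_trans (cw_le F)) // leq_mul2r cF (ltnW it) orbT.
pose Lb := \sum_(f in ~: F) c f.
have LbLa : Lb <= La by exact: cw_total.
(* With [X = cw (common F) * th] and [s] the weighted sum of [G], the strict failures add up to [Lb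
   + s * La <= Lb * X <= La * X <= La * s]. So [Lb = 0], whence [s = 0], against [0 < X <= s]. *)
have : \sum_(f in ~: F) c f * (G f * La).+1 <= Lb * (cw (common F) * th).
  rewrite /Lb big_distrl /=; apply: leq_sum => f; rewrite in_setC => fF.
  by rewrite leq_mul2l G_lt ?orbT.
have -> : \sum_(f in ~: F) c f * (G f * La).+1 = Lb + (\sum_(f in ~: F) c f * G f) * La.
  rewrite /Lb big_distrl -big_split /=; apply: eq_bigr => f _.
  by rewrite mulnS mulnA.
have X0 : 0 < cw (common F) * th by rewrite muln_gt0 cF0.
move: swap X0 LbLa La0; move: (\sum_(f in ~: F) c f * G f) (cw _ * th) Lb => s X y.
move=> sX X0 yL L0 h.
have h1 : X * La <= s * La by rewrite leq_mul2r sX orbT.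
have h2 : y * X <= La * X by rewrite leq_mul2r yL orbT.
have y0 : y = 0 by move: h1 h2 h; rewrite [La * X]mulnC; lia.
move: h; rewrite y0 mul0n add0n leqn0 muln_eq0 => /orP[]; lia.
Qed.

(** After [t] rounds of [grow_common] the common neighbourhood has at most [t] elements, since
    otherwise [t] of them would form a [K_{t,t}] with [F]. *)
Lemma heavy_bound : 0 < t -> cw heavy * th ^ t <= t * M * La ^ t.
Proof.
move=> t0; have [zero|pos] := posnP (cw heavy * th); last first.
  have [F cF hF] := grow_common pos (leqnn t).
  apply: leq_trans hF _; rewrite leq_mul2r; apply/orP; right.
  apply: leq_trans (cw_le _) _; rewrite leq_mul2r; apply/orP; right.
  rewrite leqNgt; apply/negP => big.
  have [A Acom cA] : exists2 A : {set T}, A \subset common F & #|A| = t.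
    have : 0 < #|[set A : {set T} | A \subset common F & #|A| == t]|.
      by rewrite cards_draws bin_gt0 ltnW.
    by rewrite card_gt0 => /set0Pn [A]; rewrite inE => /andP[AF /eqP cA]; exists A.
  have [e [f [eA fF]]] := noK cA cF.
  have := subsetP Acom e eA; rewrite inE => /andP[_ /forallP /(_ f)].
  by rewrite fF /= => ->.
by move: zero => /eqP; rewrite muln_eq0 => /orP[] /eqP ->; rewrite ?mul0n // exp0n // muln0.
Qed.

(** [P] is the weight of the heavy elements: these have few in total and degree at most [La], the
    light ones have degree below [th + t * M]. *)
Lemma weighted_kst : 0 < t -> exists P, P * th ^ t <= t * M * La ^ t /\
  \sum_e \sum_(f | D e f) c e * c f <= P * La + La * (th + t * M).
Proof.
move=> t0; exists (cw heavy); split; first exact: heavy_bound.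
have -> : \sum_e \sum_(f | D e f) c e * c f = \sum_e c e * degree e.
  by apply: eq_bigr => e _; rewrite big_distrr.
rewrite (bigID (mem heavy)) /= leq_add //.
  rewrite /cw big_distrl /=; apply: leq_sum => e _.
  rewrite leq_mul2l; apply/orP; right.
  by apply: leq_trans cLa; rewrite [X in _ <= X](bigID (D e)) /= leq_addr.
apply: leq_trans (_ : \sum_(e | e \notin heavy) c e * (th + t * M) <= _).
  apply: leq_sum => e; rewrite inE -ltnNge => h.
  by rewrite leq_mul2l (ltnW h) orbT.
rewrite -big_distrl /= leq_mul2r; apply/orP; right.
by apply: leq_trans cLa; rewrite [X in _ <= X](bigID (mem heavy)) /= leq_addl.
Qed.
End WeightedKST.

(** * Counting bad pairs of paths *)

Section Counting.
Variables (V : finType) (adj : rel V) (D : rel {set V}).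
Variables (x : {set V} -> V -> bool) (B : rel V) (chi : V -> bool).
Hypothesis B_tournament : forall u v, u != v -> B u v = ~~ B v u.
Hypothesis adj_chi : forall u v, adj u v -> chi u != chi v.
Hypothesis non_disjoint_cross : forall u w a b, adj u w -> adj a b ->
  [disjoint [set u; w] & [set a; b]] -> ~~ D [set u; w] [set a; b] -> crossing_formula x B u w a b.

Variables (S U : {set V}) (Rt : {set V * V}) (pi : V * V -> seq V).
Hypothesis Uchi : monochromatic chi U.
Hypothesis Rt_routing : routing adj S Rt pi.
Hypothesis Rt_U : forall v w, v \in U -> w \in U -> (v, w) \in Rt.

Definition path_edges (s : seq V) : seq {set V} := if s is u :: p then steps u p else [::].

Definition meet (d d' : V * V) : bool := [exists v in S, (v \in pi d) && (v \in pi d')].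
Definition clash (d d' : V * V) : bool :=
  [exists e, exists f, [&& D e f, e \in path_edges (pi d) & f \in path_edges (pi d')]].
Definition bad : {set (V * V) * (V * V)} :=
  [set dd | [&& dd.1 \in Rt, dd.2 \in Rt & meet dd.1 dd.2 || clash dd.1 dd.2]].

Lemma routedE d : d \in Rt ->
  exists p, [/\ pi d = d.1 :: p, path adj d.1 p & last d.1 p = d.2].
Proof.
have [_ rt] := Rt_routing; move/rt; rewrite /routed; case: (pi d) => [|y p] //.
by case/and3P => /eqP -> /and3P[pp /eqP lp _] _; exists p.
Qed.

Lemma routed_in d v : d \in Rt -> v \in pi d -> v \in S.
Proof.
have [_ rt] := Rt_routing; move/rt; rewrite /routed; case: (pi d) => [|y p] //.
by case/and3P => _ /and3P[_ _ /allP h] _; exact: h.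
Qed.

Definition bad_at (f : 'I_5 -> V) (q : 'I_5 * 'I_5 * ('I_5 * 'I_5)) : bool :=
  uniq [:: q.1.1; q.1.2; q.2.1; q.2.2] &&
  (((f q.1.1, f q.1.2), (f q.2.1, f q.2.2)) \in bad).

(** Ends of equal colour make the paths even. If no independent pair were bad, [path_path_parity]
    would yield all equations that [k5_cancel] refutes. *)
Lemma k5_bad (f : 'I_5 -> V) : injective f -> (forall i, f i \in U) -> exists q, bad_at f q.
Proof.
move=> fi fU; apply/existsP; apply: contraT; rewrite negb_exists => /forallP no.
exfalso; pose F n := f (inord n).
have F_inj i j : i < 5 -> j < 5 -> i != j -> F i != F j.
  by move=> i5 j5; apply: contra => /eqP /fi /(congr1 val) /=; rewrite !inordK // => ->.
have FU i : F i \in U by exact: fU.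
(* [X i j k] is the sum of [x] along the path from [F i] to [F j], seen from [F k]; [behead] drops
   the starting vertex, which [path_sum] takes separately. *)
apply: (@k5_cancel (fun i j k => path_sum x (F i, behead (pi (F i, F j))) (F k))
  (fun i j => B (F i) (F j))).
  move=> i j ij j5; apply: B_tournament; apply: F_inj => //; first exact: ltn_trans ij j5.
  by rewrite gtn_eqF.
move=> i j k l ij kl /and4P[ik il jk jl] i5 j5 k5 l5.
have [p [dE pp lp]] := routedE (Rt_U (FU i) (FU j)).
have [q [d'E pq lq]] := routedE (Rt_U (FU k) (FU l)).
have := no ((inord i, inord j), (inord k, inord l)).
rewrite /bad_at /= !inE -!val_eqE /= !inordK // !negb_or ik il jk jl !(ltn_eqF ij, ltn_eqF kl) /=.
rewrite !Rt_U //= negb_or => /andP[nm nc].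
move: dE pp lp d'E pq lq => /= dE pp lp d'E pq lq.
rewrite dE d'E /=.
have := path_path_parity non_disjoint_cross pp pq; rewrite lp lq => <-.
- have := path_chi adj_chi pp; rewrite lp (Uchi (FU j) (FU i)).
  by case: (odd (size p)); case: (chi (F i)).
- move=> v vp; apply/negP => vq; move/negP: nm; apply; apply/existsP; exists v.
  have dR : (F i, F j) \in Rt by apply: Rt_U.
  by rewrite (routed_in dR) ?dE //= d'E vp.
- move=> e g ep gq; apply/negP => eg; move/negP: nc; apply; apply/existsP; exists e.
  by apply/existsP; exists g; rewrite dE d'E eg ep.
Qed.

Lemma five_cover (T : finType) (s : seq 'I_5) (f g : {ffun 'I_5 -> T}) :
  uniq s -> size s = 5 -> (forall i, i \in s -> f i = g i) -> f = g.
Proof.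
move=> us ss fg; apply/ffunP => i; apply: fg.
have /subset_cardP E : #|s| = #|'I_5| by rewrite card_ord (card_uniqP us).
by rewrite (E _) //; exact: subset_predT.
Qed.

(** Each injective five-tuple in [U] has a bad pair at one of at most [5 ^ 4] positions. Given the
    position, the bad pair determines four entries, and the fifth has [#|U|] choices. *)
Lemma count_bad : #|U| ^_ 5 <= 5 ^ 4 * (#|U| * #|bad|).
Proof.
pose I := [set f : {ffun 'I_5 -> V} in ffun_on (mem U) | injectiveb f].
have -> : #|U| ^_ 5 = #|I| by rewrite /I card_inj_ffuns_on card_ord.
have fiber q : #|[set f in I | bad_at f q]| <= #|U| * #|bad|.
  case: q => [[i j] [k l]]; have [u4|nu] := boolP (uniq [:: i; j; k; l]); last first.
    rewrite (_ : [set f in I | _] = set0) ?cards0 //; apply/setP => f.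
    by rewrite in_set in_set0 /bad_at (negbTE nu) andbF.
  have [m mN] : exists m : 'I_5, m \notin [:: i; j; k; l].
    apply/existsP; rewrite -negb_forall; apply/negP => /forallP all4.
    have : #|'I_5| <= #|[:: i; j; k; l]| by apply: subset_leq_card; apply/subsetP => m _; exact: all4.
    by rewrite card_ord (card_uniqP u4).
  pose F (f : {ffun 'I_5 -> V}) := (f m, ((f i, f j), (f k, f l))).
  rewrite -cardsX -(card_in_imset (f := F)); last first.
    move=> f g _ _ [em ei ej ek el].
    apply: (@five_cover _ (m :: [:: i; j; k; l])); rewrite ?cons_uniq ?mN //= => y.
    by rewrite !inE => /or4P[/eqP->|/eqP->|/eqP->|/orP[]/eqP->].
  apply: subset_leq_card; apply/subsetP => y /imsetP[f]; rewrite !in_set.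
  move=> /andP[/andP[/ffun_onP fU _] /andP[_ hb]] ->.
  by rewrite /= fU; move: hb; rewrite in_set.
have <- : #|{: 'I_5 * 'I_5 * ('I_5 * 'I_5)}| = 5 ^ 4 by rewrite !card_prod !card_ord.
apply: leq_trans (_ : \sum_q #|[set f in I | bad_at f q]| <= _); last first.
  by rewrite -[X in _ <= X]sum_nat_const; apply: leq_sum => q _; exact: fiber.
rewrite -sum1_card.
have -> : \sum_q #|[set f in I | bad_at f q]| =
   \sum_(f in I) \sum_(q | bad_at f q) 1.
  rewrite (exchange_big_dep xpredT) //=; apply: eq_bigr => q _.
  by rewrite -sum1_card; apply: eq_bigl => f; rewrite in_set.
apply: leq_sum => f; rewrite in_set => /andP[/ffun_onP fU /injectiveP fi].
have [q bq] := k5_bad fi fU.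
by rewrite (bigD1 q) //= leq_addr.
Qed.

Definition edge_load (e : {set V}) : nat := #|[set d in Rt | e \in path_edges (pi d)]|.

(** Union bound: a meeting is charged to a common vertex, a clash to a pair of edges in relation
    [D]. *)
Lemma card_bad : #|bad| <=
  \sum_(v in S) load Rt pi v ^ 2 + \sum_e \sum_(f | D e f) edge_load e * edge_load f.
Proof.
have pairs (P P' : pred (V * V)) :
    \sum_(dd : (V * V) * (V * V)) (P dd.1 && P' dd.2) = #|[set d | P d]| * #|[set d | P' d]|.
  rewrite -!sum1_card big_distrlr /= pair_big_dep /= [RHS]big_mkcond /=.
  by apply: eq_bigr => -[d d'] _; rewrite !inE; case: (_ && _).
have -> : \sum_(v in S) load Rt pi v ^ 2 = \sum_(dd : (V * V) * (V * V)) \sum_(v in S)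
    [&& (dd.1 \in Rt) && (v \in pi dd.1), dd.2 \in Rt & v \in pi dd.2].
  rewrite exchange_big /=; apply: eq_bigr => v _.
  by rewrite (pairs (fun d => (d \in Rt) && (v \in pi d)) (fun d => (d \in Rt) && (v \in pi d))) mulnn.
have -> : \sum_e \sum_(f | D e f) edge_load e * edge_load f =
    \sum_(dd : (V * V) * (V * V)) \sum_e \sum_(f | D e f)
      [&& (dd.1 \in Rt) && (e \in path_edges (pi dd.1)), dd.2 \in Rt & f \in path_edges (pi dd.2)].
  rewrite exchange_big /=; apply: eq_bigr => e _; rewrite exchange_big /=; apply: eq_bigr => f _.
  by rewrite (pairs (fun d => (d \in Rt) && (e \in path_edges (pi d)))
    (fun d => (d \in Rt) && (f \in path_edges (pi d)))).
rewrite -big_split /= -sum1_card big_mkcond /=; apply: leq_sum => -[d d'] _ /=.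
rewrite inE /=; case: ifP => // /and3P[dR d'R]; rewrite dR d'R /=.
case/orP => [/existsP[v /and3P[vS vd vd']]|/existsP[e /existsP[f /and3P[ef ed fd']]]].
  by rewrite (bigD1 v) //= vd vd' -addnA leq_addr.
by rewrite addnC (bigD1 e) //= (bigD1 f) //= ed fd' -!addnA leq_addr.
Qed.

Lemma path_edges_sub s e v : e \in path_edges s -> v \in e -> v \in s.
Proof.
case: s => [|u p] //=; elim: p u => [|y p IH] u //=.
rewrite in_cons => /orP[/eqP ->|/IH h /h {}h]; last by rewrite [v \in u :: _]in_cons h orbT.
by rewrite !inE => /orP[->|->]; rewrite ?orbT.
Qed.

Lemma path_edges_neq0 s e : e \in path_edges s -> exists v, v \in e.
Proof.
case: s => [|u p] //=; elim: p u => [|y p IH] u //=.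
by rewrite in_cons => /orP[/eqP ->|/IH //]; exists u; rewrite set21.
Qed.

(** Every path through an edge passes through each vertex of that edge, so a single summand of the
    potential suffices. *)
Lemma edge_load_sqr e : edge_load e ^ 2 <= potential S Rt pi.
Proof.
have [->|] := posnP (edge_load e); first by [].
rewrite /edge_load card_gt0 => /set0Pn [d]; rewrite inE => /andP[dR ed].
have [v ve] := path_edges_neq0 ed.
have vS := routed_in dR (path_edges_sub ed ve).
rewrite /potential (bigD1 v) //= -[X in X <= _]addn0 leq_add // leq_exp2r //.
rewrite ltnW // ltnS; apply: subset_leq_card; apply/subsetP => d'.
by rewrite !inE => /andP[-> ed'] /=; exact: path_edges_sub ed' ve.
Qed.

(** Double counting: a simple path has fewer edges than vertices. *)
Lemma sum_load : \sum_e edge_load e <= \sum_(v in S) load Rt pi v.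
Proof.
have count (I : finType) (A : pred I) (Q : I -> V * V -> bool) :
    \sum_(i | A i) #|[set d in Rt | Q i d]| = \sum_(d in Rt) #|[set i | A i && Q i d]|.
  transitivity (\sum_(i | A i) \sum_(d in Rt | Q i d) 1).
    by apply: eq_bigr => i _; rewrite -sum1_card; apply: eq_bigl => d; rewrite inE.
  rewrite (exchange_big_dep (mem Rt)) /=; last by move=> i d _ /andP[].
  apply: eq_bigr => d dR; rewrite -sum1_card; apply: eq_bigl => i.
  by rewrite inE; move: dR => /= ->.
rewrite /edge_load /load !count; apply: leq_sum => d dR.
have [_ rt] := Rt_routing; have := rt d dR.
have inS := fun v => @routed_in d v dR.
rewrite /routed; case E : (pi d) => [|y p] // /and3P[_ _ us].
have -> : [set v | (v \in S) && (v \in y :: p)] = [set v in y :: p].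
  apply/setP => v; rewrite !inE; apply/andP/idP => [[]//|vp]; split=> //.
  by apply: inS; rewrite E inE.
rewrite [X in _ <= X]cardsE (card_uniqP us) cardsE.
apply: leq_trans (card_size _) _.
by rewrite size_pairmap.
Qed.
End Counting.

(** * Numerical estimates *)

Lemma poly_le_exp (a d : nat) : exists k0, forall k, k0 <= k -> a * k.+2 ^ d <= 2 ^ k.
Proof.
elim: d a => [|d IH] a.
  by exists a => k ak; rewrite muln1; apply: leq_trans ak (ltnW (ltn_expl _ _)).
have [k0 h0] := IH (2 * (a * 2 ^ d.+1)).
(* Halving [k]: one factor [2 ^ j] absorbs the power of degree [d], the other one the additional
   linear factor. *)
exists (2 * k0).+1 => k hk; set j := k./2.
have jk : j + j <= k <= (j + j).+1 by rewrite /j; lia.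
have kj : k.+2 <= 2 * j.+2 by lia.
apply: leq_trans (_ : a * (2 * j.+2) ^ d.+1 <= _); first by rewrite leq_mul2l leq_exp2r // kj orbT.
apply: leq_trans (_ : 2 ^ (j + j) <= _); last by rewrite leq_exp2l //; lia.
have h1 : 2 * (a * 2 ^ d.+1) * j.+2 ^ d <= 2 ^ j by apply: h0; lia.
have h2 : j.+2 <= 2 * 2 ^ j by have := ltn_expl j (isT : 1 < 2); lia.
rewrite -(leq_pmul2l (isT : 0 < 2)) expnD.
have -> : 2 * (a * (2 * j.+2) ^ d.+1) = (2 * (a * 2 ^ d.+1) * j.+2 ^ d) * j.+2.
  by rewrite expnMn [j.+2 ^ d.+1]expnSr; move: (2 ^ d.+1) (j.+2 ^ d) => y z; lia.
by apply: leq_trans (leq_mul h1 h2) _; rewrite mulnCA.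
Qed.

(** After cancelling [u], each of the four remaining factors is at least [u - 4], and hence at least
    [u / 2], because [128 <= h] gives [8 <= u]. *)
Lemma ffact5_bound (u b h : nat) : h <= 16 * u -> 128 <= h -> u ^_ 5 <= 5 ^ 4 * (u * b) ->
  h ^ 4 <= 16 ^ 4 * (16 * (5 ^ 4 * b)).
Proof.
move=> hu h8; have u8 : 8 <= u by lia.
rewrite ffactnS mulnCA leq_pmul2l; last by lia.
move=> ub.
have u4 : u ^ 4 <= 16 * u.-1 ^_ 4.
  apply: leq_trans (_ : (2 * (u - 4)) ^ 4 <= _); first by rewrite leq_exp2r //; lia.
  rewrite expnMn leq_mul2l; apply/orP; right; rewrite !ffactnS ffactn0 muln1.
  by rewrite !expnS expn0 muln1 !leq_mul //; lia.
apply: leq_trans (_ : (16 * u) ^ 4 <= _); first by rewrite leq_exp2r.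
rewrite expnMn leq_mul //; apply: leq_trans u4 _.
by rewrite leq_mul.
Qed.

Section Arithmetic.
Variables (N t : nat).
Hypothesis N0 : 0 < N.
Hypothesis t0 : 0 < t.

Let Y L := 12 * N * L * t * ((72 * N * L ^ 2) ^ t).+1.
(** The summand 128 is for [ffact5_bound], the second one for the potential and for [th > 0], and
    the third one makes [Y L * M <= h ^ 2], where [Y L * M] dominates [12 * N * L * (P + t * M)]. *)
Definition threshold L := 128 + 36 * N * L ^ 2 + 9 * L ^ 2 * Y L ^ 2.

Lemma threshold_poly : exists C d, forall L, 0 < L -> threshold L <= C * L ^ d.
Proof.
exists (128 + 36 * N + 9 * (12 * N * t * (72 * N) ^ t.+1) ^ 2); exists (2 + (1 + 2 * t.+1) * 2) => L L0.
have Lk d : 0 < L ^ d by rewrite expn_gt0 L0.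
have mono d d' : d <= d' -> L ^ d <= L ^ d' by move=> dd; rewrite leq_pexp2l.
set X := 12 * N * t * _; set e := 1 + _.
have h1 : 128 <= 128 * L ^ (2 + e * 2) by rewrite leq_pmulr.
have h2 : 36 * N * L ^ 2 <= 36 * N * L ^ (2 + e * 2) by rewrite leq_mul2l mono ?orbT // leq_addr.
rewrite /threshold mulnDl [(128 + _) * _]mulnDl; apply: (leq_add (leq_add h1 h2)).
have -> : 9 * X ^ 2 * L ^ (2 + e * 2) = 9 * L ^ 2 * (X * L ^ e) ^ 2.
  by rewrite expnD expnMn -[(L ^ e) ^ 2]expnM mulnACA.
rewrite leq_mul2l; apply/orP; right; rewrite leq_exp2r // /Y.
have y1 : ((72 * N * L ^ 2) ^ t).+1 <= (72 * N * L ^ 2) ^ t.+1.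
  have z1 : 1 < 72 * N * L ^ 2 by have := Lk 2; nia.
  move: (72 * N * L ^ 2) z1 => z z1; rewrite expnS.
  have : 0 < z ^ t by rewrite expn_gt0 ltnW.
  by move: (z ^ t) => y; nia.
apply: leq_trans (_ : 12 * N * L * t * (72 * N * L ^ 2) ^ t.+1 <= _).
  by rewrite leq_mul2l y1 orbT.
rewrite (expnMn (72 * N)) -expnM /e expnD expn1 /X.
by move: ((72 * N) ^ t.+1) (L ^ (2 * t.+1)) => y z; lia.
Qed.

(** Meetings, pairs with a light first edge, and heavy edges together with the slack [t * M] each
    account for at most a quarter of [h ^ 4]. *)
Lemma count_contradiction (L h Phi M Q : nat) : 0 < L -> threshold L <= h ->
  Phi <= 9 * L ^ 2 * h ^ 3 -> M ^ 2 <= 9 * L ^ 2 * h ^ 3 ->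
  (forall th, exists P, P * th ^ t <= t * M * (3 * L * h ^ 2) ^ t /\
     Q <= P * (3 * L * h ^ 2) + 3 * L * h ^ 2 * (th + t * M)) ->
  N * (Phi + Q) < h ^ 4.
Proof.
move=> L0 hh hPhi hM hQ.
have h0 : 0 < h by apply: leq_trans hh; rewrite /threshold; lia.
(* The largest [th] for which the light term [4 * N * (3 * L * h ^ 2 * th)] stays within [h ^ 4]. *)
pose s := 12 * N * L; pose th := h ^ 2 %/ s.
have s0 : 0 < s by rewrite !muln_gt0 N0.
have [P [hP {}hQ]] := hQ th.
have th1 : th * s <= h ^ 2 by exact: leq_trunc_div.
have th2 : h ^ 2 < th.+1 * s by exact: ltn_ceil.
have sh : s <= h ^ 2.
  apply: leq_trans (_ : h <= _); last by rewrite -mulnn leq_pmull.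
  apply: leq_trans hh; apply: leq_trans (_ : 36 * N * L ^ 2 <= _).
    rewrite -mulnn mulnA; apply: leq_trans (leq_pmulr _ L0).
    by rewrite !leq_mul2r /= !orbT.
  by rewrite /threshold -addnA addnCA leq_addr.
have thp : 0 < th by rewrite divn_gt0.
have th3 : h ^ 2 <= 2 * s * th.
  apply: leq_trans (ltnW th2) _; rewrite mulnAC leq_mul2r; apply/orP; right.
  by rewrite mul2n -addnn -addn1 leq_add2l.
have PB : P <= (6 * s * L) ^ t * t * M.
  have hp : 0 < (h ^ 2) ^ t by rewrite !expn_gt0 h0.
  rewrite -(leq_pmul2r hp).
  apply: leq_trans (_ : P * (2 * s * th) ^ t <= _).
    by rewrite leq_mul2l leq_exp2r // th3 orbT.
  rewrite expnMn mulnCA; apply: leq_trans (_ : (2 * s) ^ t * (t * M * (3 * L * h ^ 2) ^ t) <= _).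
    by rewrite leq_mul2l hP orbT.
  rewrite (expnMn (3 * L)) (_ : 6 * s * L = 2 * s * (3 * L)); last by clear; lia.
  by rewrite (expnMn (2 * s)); move: (_ ^ t) (_ ^ t) (_ ^ t) => y1 y2 y3; clear; lia.
have YM : Y L * M <= h ^ 2.
  rewrite -(@leq_exp2r _ _ 2) // expnMn.
  apply: leq_trans (_ : Y L ^ 2 * (9 * L ^ 2 * h ^ 3) <= _); first by rewrite leq_mul2l hM orbT.
  have -> : (h ^ 2) ^ 2 = h * h ^ 3 by rewrite -expnM -expnS.
  rewrite mulnA leq_mul2r; apply/orP; right; apply: leq_trans hh.
  by rewrite /threshold mulnC leq_addl.
have e1 : 4 * (N * Phi) <= h ^ 4.
  apply: leq_trans (_ : 4 * (N * (9 * L ^ 2 * h ^ 3)) <= _); first by rewrite !leq_mul2l hPhi !orbT.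
  have -> : 4 * (N * (9 * L ^ 2 * h ^ 3)) = 36 * N * L ^ 2 * h ^ 3 by clear; lia.
  rewrite (expnS h 3) leq_mul2r; apply/orP; right; apply: leq_trans hh.
  by rewrite /threshold -addnA addnCA leq_addr.
have h4 : h ^ 4 = h ^ 2 * h ^ 2 by rewrite -expnD.
have e2 : 4 * (N * (3 * L * h ^ 2 * th)) <= h ^ 4.
  have -> : 4 * (N * (3 * L * h ^ 2 * th)) = h ^ 2 * (th * s) by rewrite /s; clear; lia.
  by rewrite h4 leq_mul2l th1 orbT.
have e3 : 4 * (N * (P * (3 * L * h ^ 2) + 3 * L * h ^ 2 * (t * M))) <= h ^ 4.
  apply: leq_trans (_ : h ^ 2 * (Y L * M) <= _); last by rewrite h4 leq_mul2l YM orbT.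
  have -> : 4 * (N * (P * (3 * L * h ^ 2) + 3 * L * h ^ 2 * (t * M))) =
    h ^ 2 * (12 * N * L * (P + t * M)) by clear; lia.
  rewrite leq_mul2l; apply/orP; right.
  have -> : Y L * M = 12 * N * L * ((72 * N * L ^ 2) ^ t * t * M + t * M).
    by rewrite /Y; move: (_ ^ t) => y; clear; lia.
  rewrite leq_mul2l leq_add2r; apply/orP; right.
  by rewrite (_ : 72 * N * L ^ 2 = 6 * s * L) //; rewrite /s -mulnn; clear; lia.
have h40 : 0 < h ^ 4 by rewrite expn_gt0 h0.
have e4 : 4 * (N * (Phi + Q)) <= 3 * h ^ 4.
  apply: leq_trans (_ : 4 * (N * (Phi + (P * (3 * L * h ^ 2) + 3 * L * h ^ 2 * (th + t * M)))) <= _).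
    by rewrite !leq_mul2l leq_add2l hQ !orbT.
  rewrite [3 * L * h ^ 2 * (th + _)]mulnDr.
  move: e2 e3; set A := P * (3 * L * h ^ 2); set C := 3 * L * h ^ 2 * (t * M).
  set B := 3 * L * h ^ 2 * th => e2 e3.
  have -> : 4 * (N * (Phi + (A + (B + C)))) = 4 * (N * Phi) + 4 * (N * B) + 4 * (N * (A + C)).
    by clear; lia.
  have -> : 3 * h ^ 4 = h ^ 4 + h ^ 4 + h ^ 4 by clear; lia.
  by rewrite !leq_add.
by move: e4 h40; clear; lia.
Qed.
End Arithmetic.

(** * The combinatorial bound *)

Lemma bichromatic_edge (V : finType) (E : {set {set V}}) (chi : V -> bool) (u v : V) :
  [set u; v] \in bichromatic E chi -> chi u != chi v.
Proof.
rewrite inE => /andP[_ /existsP[a /andP[au /existsP[b /andP[bv]]]]].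
move: au bv; rewrite !inE => /orP[/eqP ->|/eqP ->] /orP[/eqP ->|/eqP ->] //; rewrite ?eqxx //.
by rewrite eq_sym.
Qed.

(** A set of [s] vertices spans at most [s ^ 2] edges, so density at least [c] needs at least [c]
    vertices. *)
Lemma dense_large (V : finType) (E : {set {set V}}) (c : nat) (S : {set V}) :
  (forall e, e \in E -> #|e| = 2) -> dense E c S -> c <= #|S|.
Proof.
move=> E2 /andP[]; rewrite -card_gt0 => S0.
have le : #|inside E S| <= #|S| ^ 2.
  apply: leq_trans (_ : 'C(#|S|, 2) <= _).
    rewrite -cards_draws; apply: subset_leq_card; apply/subsetP => e.
    by rewrite !inE => /andP[/E2 -> ->].
  rewrite bin2 -mulnn; move: #|S| => n; have : n * n.-1 <= n * n by rewrite leq_mul2l leq_pred orbT.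
  by move: (n * n.-1) (n * n) => y z; lia.
move: (trunc_log 2 #|S|) => k h.
have : k.+1 * (c * #|S|) <= k.+1 * (#|S| * #|S|).
  apply: leq_trans (_ : c * (2 * k).+1 * #|S| <= _).
    by rewrite mulnCA mulnA leq_mul2r leq_mul2l; apply/orP; right; apply/orP; right; lia.
  by rewrite (leq_trans h) // leq_mul2l mulnn le orbT.
by rewrite leq_pmul2l // leq_pmul2r.
Qed.

(** The drawing enters only through the parity formula for its crossing relation [cr]. *)
Theorem linear_of_no_disjoint_grid (t : nat) : 0 < t -> exists c : nat,
  forall (V : finType) (E : {set {set V}}), (forall e, e \in E -> #|e| = 2) ->
  forall (cr : rel {set V}) (x : {set V} -> V -> bool) (B : rel V),
  (forall u v, u != v -> B u v = ~~ B v u) ->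
  (forall u w a b, [set u; w] \in E -> [set a; b] \in E -> [disjoint [set u; w] & [set a; b]] ->
     cr [set u; w] [set a; b] = crossing_formula x B u w a b) ->
  (forall A A' : {set {set V}}, A \subset E -> A' \subset E -> #|A| = t -> #|A'| = t ->
     exists e f, [/\ e \in A, f \in A' & ~~ ([disjoint e & f] && ~~ cr e f)]) ->
  #|E| <= c * #|V|.
Proof.
(* [N] is the factor between [h ^ 4] and the number of bad pairs in [ffact5_bound]. *)
move=> t0; pose N := 16 ^ 4 * (16 * 5 ^ 4).
have N0 : 0 < N by rewrite /N !(expn_gt0, muln_gt0).
have [C [d thr]] := threshold_poly N0 t0.
have [k0 hk0] := poly_le_exp (C * 34 ^ d) (3 * d).
(* One factor 2 is lost to the bipartite subgraph, another to the varying density. The density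
   [2 ^ k0] forces [#|S| >= 2 ^ k0], so that [h] exceeds every polylogarithm in question. *)
exists (4 * 2 ^ k0) => V E E2 cr x B Bt crE noK.
rewrite leqNgt; apply/negP => big.
have [chi half] := bichromatic_half E2.
pose E' := bichromatic E chi.
have E'E e : e \in E' -> e \in E by rewrite inE => /andP[].
have E'2 e : e \in E' -> #|e| = 2 by move/E'E; exact: E2.
have V0 : 0 < #|V|.
  have : 0 < #|E| by apply: leq_ltn_trans big.
  rewrite card_gt0 => /set0Pn [e /E2 e2].
  by apply: leq_trans (max_card (mem e)); rewrite e2.
have bigE' : 2 * 2 ^ k0 * #|V| <= #|E'|.
  rewrite -(leq_pmul2l (isT : 0 < 2)) (leq_trans _ half) // (leq_trans _ (ltnW big)) //.
  by rewrite !mulnA.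
have [S dS minS] := min_dense V0 bigE'.
have hS := dense_large E'2 dS.
have S0 : S != set0 by case/andP: dS.
pose adj u v := [set u; v] \in E'.
have adjC : symmetric adj by move=> u v; rewrite /adj setUC.
have adj_chi u v : adj u v -> chi u != chi v by exact: bichromatic_edge.
have expands := fun A K => min_dense_expands E'2 dS minS (A := A) (K := K).
have [U [Rt [pi [[US mU hU] [rRt RtU Phi_le]]]]] := routed_clique adjC chi S0 expands.
set h := #|S| in hS hU Phi_le *; set k := trunc_log 2 h in Phi_le *.
set L := 34 * k.+2 ^ 3 in Phi_le.
have k0k : k0 <= k by exact: trunc_log_max.
have L0 : 0 < L by rewrite muln_gt0 expn_gt0.
have h0 : 0 < h by rewrite card_gt0.
have hL : threshold N t L <= h.
  apply: leq_trans (thr L L0) _; apply: leq_trans (trunc_logP (isT : 1 < 2) h0).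
  apply: leq_trans (hk0 k k0k).
  by rewrite /L expnMn -expnM mulnA.
(* Membership in [E'] is built in, so that [dis] is free of [K_{t,t}] among arbitrary sets of
   vertices, over which the edge loads are summed. *)
pose dis : rel {set V} := fun e f => [&& e \in E', f \in E', [disjoint e & f] & ~~ cr e f].
have ndc u w a b : adj u w -> adj a b -> [disjoint [set u; w] & [set a; b]] ->
    ~~ dis [set u; w] [set a; b] -> crossing_formula x B u w a b.
  rewrite /adj => uw ab duwab; rewrite /dis uw ab duwab /= negbK => cuwab.
  by rewrite -crE ?E'E.
have cb := count_bad Bt adj_chi ndc mU rRt RtU.
have cb2 := card_bad dis S Rt pi.
pose M := \max_e edge_load Rt pi e.
have M_le e : edge_load Rt pi e <= M by exact: leq_bigmax.
have M2 : M ^ 2 <= potential S Rt pi.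
  have [e0] : {e0 : {set V} | true} by exists set0.
  move=> _; have := eq_bigmax (edge_load Rt pi); rewrite -/M.
  case; first by apply/card_gt0P; exists e0.
  by move=> e ->; exact: edge_load_sqr rRt e.
have La_le : \sum_e edge_load Rt pi e <= 3 * L * h ^ 2.
  apply: leq_trans (sum_load rRt) _; rewrite -(@leq_exp2r _ _ 2) //.
  apply: leq_trans (sum_sqr_le _ _) _; rewrite -/h.
  apply: leq_trans (_ : h * potential S Rt pi <= _).
    by rewrite leq_mul2l; apply/orP; right; apply: leq_sum => v _; rewrite leq_exp2r.
  apply: leq_trans (_ : h * (9 * L ^ 2 * h ^ 3) <= _); first by rewrite leq_mul2l Phi_le orbT.
  by rewrite (expnS h 2) -!mulnn; clear; lia.
have noK' (A A' : {set {set V}}) : #|A| = t -> #|A'| = t ->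
    exists e f, [/\ e \in A, f \in A' & ~~ dis e f].
  move=> cA cA'.
  have [/existsP[e /andP[eA /existsP[f /andP[fA' ndis]]]]|all_dis] :=
    boolP [exists e in A, exists f in A', ~~ dis e f]; first by exists e, f.
  have dA e f : e \in A -> f \in A' -> dis e f.
    move=> eA fA'; apply: contraNT all_dis => nd.
    by apply/existsP; exists e; rewrite eA; apply/existsP; exists f; rewrite fA'.
  have [e0 e0A] : exists e, e \in A by apply/card_gt0P; rewrite cA.
  have [f0 f0A] : exists f, f \in A' by apply/card_gt0P; rewrite cA'.
  have [||e [f [eA fA' nd]]] := noK A A' _ _ cA cA'.
  - by apply/subsetP => e eA; have /and4P[/E'E] := dA e f0 eA f0A.
  - by apply/subsetP => f fA; have /and4P[_ /E'E] := dA e0 f e0A fA.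
  by have /and4P[_ _ d1 d2] := dA e f eA fA'; rewrite d1 d2 in nd.
have kst th := weighted_kst th M_le La_le noK' t0.
have M2' : M ^ 2 <= 9 * L ^ 2 * h ^ 3 by apply: leq_trans M2 Phi_le.
have := count_contradiction N0 t0 L0 hL Phi_le M2' kst.
rewrite ltnNge => /negP; apply.
have h128 : 128 <= h by apply: leq_trans hL; rewrite /threshold -addnA leq_addr.
apply: leq_trans (ffact5_bound hU h128 cb) _.
rewrite /N -!mulnA !leq_mul2l; apply/orP; right; apply/orP; right; apply/orP; right.
apply: leq_trans cb2 _; rewrite leq_add2r; apply: leq_sum => v _.
by rewrite leq_exp2r.
Qed.

(** * Crossing parity of plane arcs *)

From mathcomp Require Import ring lra.
From mathcomp Require Import all_classical all_reals all_analysis.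

Import Order.TTheory GRing.Theory Num.Theory numFieldNormedType.Exports.

Section PlaneParity.
Local Open Scope classical_set_scope.
Local Open Scope ring_scope.

(** * Branches of the complex square root *)

Section Parity.
Variable R : realType.
Notation plane := (Real.sort R * Real.sort R)%type.
Implicit Types (z w : plane).

Definition dot z w : R := z.1 * w.1 + z.2 * w.2.
Definition csquare z : plane := (z.1 ^+ 2 - z.2 ^+ 2, 2 * z.1 * z.2).
Definition quarter_turn z : plane := (- z.2, z.1).

(** The half-angle formulas, with [n] the modulus. *)
Lemma csquare_surj z : exists r, csquare r = z.
Proof.
case: z => x y; rewrite /csquare /=.
pose n := Num.sqrt (x ^+ 2 + y ^+ 2).
have n2 : n ^+ 2 = x ^+ 2 + y ^+ 2 by rewrite sqr_sqrtr // addr_ge0 ?sqr_ge0.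
have n0 : 0 <= n by exact: sqrtr_ge0.
have p0 : 0 <= (n + x) / 2 by nra.
have m0 : 0 <= (n - x) / 2 by nra.
pose p := Num.sqrt ((n + x) / 2); pose m := Num.sqrt ((n - x) / 2).
have p2 : p ^+ 2 = (n + x) / 2 by rewrite sqr_sqrtr.
have m2 : m ^+ 2 = (n - x) / 2 by rewrite sqr_sqrtr.
have pm : 2 * (p * m) = `|y|.
  apply/eqP; rewrite -(@eqrXn2 _ 2) ?mulr_ge0 ?sqrtr_ge0 //.
  rewrite real_normK ?num_real // !exprMn p2 m2; apply/eqP.
  have -> : 2 ^+ 2 * ((n + x) / 2 * ((n - x) / 2)) = n ^+ 2 - x ^+ 2 by field.
  by rewrite n2; ring.
have [y0|y0] := leP 0 y.
- exists (p, m) => /=; congr pair; first by rewrite p2 m2; field.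
  by rewrite -mulrA pm ger0_norm.
- exists (p, - m) => /=; congr pair; first by rewrite sqrrN p2 m2; field.
  by rewrite -mulrA mulrN mulrN pm ltr0_norm // opprK.
Qed.

Definition csqrt z : plane := sval (cid (csquare_surj z)).

Lemma csqrtK z : csquare (csqrt z) = z.
Proof. by rewrite /csqrt; case: cid. Qed.

Lemma dot_csquare z w :
  dot (csquare z) (csquare w) = dot z w ^+ 2 - dot z (quarter_turn w) ^+ 2.
Proof. by rewrite /dot /=; ring. Qed.

Lemma dotE z w : dot z w =
  dot (csqrt z) (csqrt w) ^+ 2 - dot (csqrt z) (quarter_turn (csqrt w)) ^+ 2.
Proof. by rewrite -dot_csquare !csqrtK. Qed.

(** For vectors at an acute angle the lines through their square roots differ by less than 45
    degrees; [flip] tells whether the chosen roots point in opposite directions along them. *)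
Definition flip z w : bool := dot (csqrt z) (csqrt w) < 0.

Lemma flipC z w : flip z w = flip w z.
Proof. by rewrite /flip /dot mulrC [X in _ + X]mulrC. Qed.

(** Up to the positive factor [dot b b], the product of the roots of [z] and [v] is
    [p * q - p' * q']. The acute angles make [p * q] dominate, so signs multiply. *)
Lemma flip_trans z w v : 0 < dot z w -> 0 < dot w v ->
  flip z v = flip z w (+) flip w v.
Proof.
rewrite (dotE z w) (dotE w v) /flip.
move: (csqrt z) (csqrt w) (csqrt v) => a b c.
set p := dot a b; set q := dot b c.
set p' := dot a (quarter_turn b); set q' := dot b (quarter_turn c) => hp hq.
have bb : 0 < dot b b.
  rewrite lt0r; apply/andP; split; last by rewrite addr_ge0 // -expr2 sqr_ge0.
  apply/eqP => /eqP; rewrite paddr_eq0 -?expr2 ?sqr_ge0 // !sqrf_eq0.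
  by case/andP => /eqP b1 /eqP b2; move: hq; rewrite /q /q' /dot b1 b2 /= !mul0r subrr ltxx.
have E : dot a c * dot b b = p * q - p' * q' by rewrite /p /q /p' /q' /dot /=; ring.
have pq : (p' * q') ^+ 2 < (p * q) ^+ 2.
  rewrite !exprMn; have := sqr_ge0 p'; have := sqr_ge0 q'; nra.
have -> : (dot a c < 0) = (p * q < 0).
  rewrite -(pmulr_llt0 _ bb) E.
  have := pq; rewrite -[X in _ < X]real_normK ?num_real // -[X in X < _]real_normK ?num_real //.
  rewrite ltr_pXn2r ?nnegrE // => pq'.
  have [h|h] := ltP (p * q) 0.
    by move: pq'; rewrite (ltr0_norm h) ltr_norml => /andP[h1 h2]; lra.
  by move: pq'; rewrite (ger0_norm h) ltr_norml => /andP[h1 h2]; apply/negbTE; rewrite -leNgt; lra.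
have p0 : p != 0 by apply/eqP => p0; move: hp; rewrite p0 expr0n /=; have := sqr_ge0 p'; lra.
have q0 : q != 0 by apply/eqP => q0; move: hq; rewrite q0 expr0n /=; have := sqr_ge0 q'; lra.
case: (ltgtP p 0) p0 => // p0 _; case: (ltgtP q 0) q0 => // q0 _ /=; by [nra | apply/negbTE; rewrite -leNgt; nra].
Qed.

(* Both [csqrt (- z)] and the quarter turn of [csqrt z] are square roots of [- z]. *)
Definition turned z : bool := csqrt (- z) != quarter_turn (csqrt z).

Lemma csquare_inj z w : csquare z = csquare w -> z = w \/ z = - w.
Proof.
case: z w => [a b] [c d] [] /= h1 h2.
have e : ((a - c) ^+ 2 + (b - d) ^+ 2) * ((a + c) ^+ 2 + (b + d) ^+ 2) = 0.
  have -> : ((a - c) ^+ 2 + (b - d) ^+ 2) * ((a + c) ^+ 2 + (b + d) ^+ 2) =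
    ((a ^+ 2 - b ^+ 2) - (c ^+ 2 - d ^+ 2)) ^+ 2 + (2 * a * b - 2 * c * d) ^+ 2 by ring.
  by rewrite h1 h2 !subrr expr0n addr0.
move/eqP: e; rewrite mulf_eq0 !paddr_eq0 ?sqr_ge0 // !sqrf_eq0 !subr_eq0 !addr_eq0.
by case/orP => /andP[/eqP -> /eqP ->]; [left|right].
Qed.

Lemma csqrtN z : csqrt (- z) =
  (if turned z then - quarter_turn (csqrt z) else quarter_turn (csqrt z)).
Proof.
rewrite /turned; case: eqP => //= ne.
have : csquare (csqrt (- z)) = csquare (quarter_turn (csqrt z)).
  rewrite csqrtK -[in LHS](csqrtK z) /csquare /=; congr pair; rewrite /=; ring.
by case/csquare_inj.
Qed.

(** Two quarter turns make a half turn, so exactly one of the passages from [z] to [- z] and back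
    departs from the quarter turn. *)
Lemma turnedN z : z != 0 -> turned (- z) = ~~ turned z.
Proof.
move=> z0; have r0 : csqrt z != 0.
  apply: contra_neq z0 => h; rewrite -(csqrtK z) h /csquare /=.
  by rewrite !expr0n /= !mulr0 subrr.
have := csqrtN (- z); rewrite opprK csqrtN.
case: (turned z); case: (turned (- z)) => //=; case: (csqrt z) r0 => a b r0 [] /= h1 h2;
 by case/eqP: r0; congr pair; lra.
Qed.

Lemma flipN z w : 0 < dot z w ->
  flip (- z) (- w) = flip z w (+) (turned z (+) turned w).
Proof.
rewrite dotE /flip => h.
rewrite !csqrtN; move: (csqrt z) (csqrt w) h => a b h.
have d0 : dot a b != 0.
  by apply/eqP => d0; move: h; rewrite d0 expr0n /=; have := sqr_ge0 (dot a (quarter_turn b)); lra.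
have e1 : dot (quarter_turn a) (quarter_turn b) = dot a b by rewrite /dot /=; ring.
have e2 x y : dot (- x) y = - dot x y by rewrite /dot /=; ring.
have e3 x y : dot x (- y) = - dot x y by rewrite /dot /=; ring.
have e4 : (- dot a b < 0) = ~~ (dot a b < 0) by rewrite oppr_lt0 -leNgt le0r (negbTE d0).
by case: (turned z); case: (turned w); rewrite /= ?e2 ?e3 e1 ?opprK ?e4 ?addbT ?addbF ?negbK.
Qed.

(* For a closed polygon with short edges this is its winding number about 0, modulo 2. *)
Definition walk (f : nat -> plane) n : bool := \big[addb/false]_(i < n) flip (f i) (f i.+1).

Lemma walkS f n : walk f n.+1 = walk f n (+) flip (f n) (f n.+1).
Proof. by rewrite /walk big_ord_recr. Qed.

(** Cell by cell: both ways around a unit cell give the flip along its diagonal, by [flip_trans]. *)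
Lemma grid_walk (Z : nat -> nat -> plane) m n :
  (forall i j, (i < m)%N -> (j <= n)%N -> 0 < dot (Z i j) (Z i.+1 j)) ->
  (forall i j, (i <= m)%N -> (j < n)%N -> 0 < dot (Z i j) (Z i j.+1)) ->
  walk (fun i => Z i 0%N) m (+) walk (fun j => Z m j) n =
  walk (fun j => Z 0%N j) n (+) walk (fun i => Z i n) m.
Proof.
elim: m => [|m IHm] h1 h2; first by rewrite /walk !big_ord0 /= addbF.
have {IHm} IH := IHm (fun i j im => h1 i j (ltnW im)) (fun i j im => h2 i j (leqW im)).
rewrite !walkS addbA -{}IH -!addbA; congr (_ (+) _).
have {h1 h2} [h1 h2 h3] : [/\ forall j, (j <= n)%N -> 0 < dot (Z m j) (Z m.+1 j),
  forall j, (j < n)%N -> 0 < dot (Z m j) (Z m j.+1)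
  & forall j, (j < n)%N -> 0 < dot (Z m.+1 j) (Z m.+1 j.+1)].
  by split=> j jn; [apply: h1|apply: h2|apply: h2].
elim: n h1 h2 h3 => [|n IH] h1 h2 h3; first by rewrite /walk !big_ord0 /= addbF.
have {IH} IHn := IH (fun j jn => h1 j (leqW jn)) (fun j jn => h2 j (ltnW jn)) (fun j jn => h3 j (ltnW jn)).
rewrite !walkS addbA IHn -!addbA; congr (_ (+) _).
by rewrite -!flip_trans //; [apply: h2|apply: h1|apply: h1; exact: ltnW|apply: h3].
Qed.

End Parity.

(** * Winding numbers modulo 2 *)

Section Top.
Variable R : realType.
Notation plane := (Real.sort R * Real.sort R)%type.
Lemma dot_continuous (T : topologicalType) (f g : T -> plane) (x : T) :
  {for x, continuous f} -> {for x, continuous g} -> {for x, continuous (fun y => dot (f y) (g y))}.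
Proof.
move=> cf cg; apply: cvgD; apply: cvgM.
- exact: (cvg_comp _ _ cf (@cvg_fst _ _ _ _ _)).
- exact: (cvg_comp _ _ cg (@cvg_fst _ _ _ _ _)).
- exact: (cvg_comp _ _ cf (@cvg_snd _ _ _ _ _)).
- exact: (cvg_comp _ _ cg (@cvg_snd _ _ _ _ _)).
Qed.

Lemma cont_pair (T U V : topologicalType) (f : T -> U) (g : T -> V) :
  continuous f -> continuous g -> continuous (fun x => (f x, g x)).
Proof. by move=> cf cg x; exact: (cvg_pair (cf x) (cg x)). Qed.

Lemma cont_comp (T U V : topologicalType) (f : T -> U) (g : U -> V) :
  continuous f -> continuous g -> continuous (fun x => g (f x)).
Proof. by move=> cf cg x; apply: (@continuous_comp _ _ _ f g); [exact: cf|exact: cg]. Qed.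

Lemma fst_continuous (T U : topologicalType) : continuous (@fst T U).
Proof. by move=> x; exact: cvg_fst. Qed.

Lemma snd_continuous (T U : topologicalType) : continuous (@snd T U).
Proof. by move=> x; exact: cvg_snd. Qed.

Lemma cont_cst (T U : topologicalType) (u : U) : continuous (fun _ : T => u).
Proof. by move=> x; exact: cvg_cst. Qed.

Lemma dot_self_gt0 (z : plane) : z != 0 -> 0 < dot z z.
Proof.
move=> z0; rewrite lt0r /dot -!expr2 addr_ge0 ?sqr_ge0 // andbT.
apply: contra z0; rewrite paddr_eq0 ?sqr_ge0 // !sqrf_eq0.
by case: z => a b /= /andP[/eqP -> /eqP ->].
Qed.

(** Uniform continuity on a compact set. The radius is twice the mesh [1 / N] because balls are
    open. *)
Lemma dot_gt0_near (T : pseudoMetricType R) (K : set T) (F : T -> plane) :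
  compact K -> continuous F -> (forall x, K x -> F x != 0) ->
  \forall N \near \oo, forall x, K x -> forall y, ball x (2 / N%:R) y -> 0 < dot (F x) (F y).
Proof.
move=> /compact_near_coveringP Kc cF F0.
apply: (Kc _ _ (fun N x => forall y, ball x (2 / N%:R) y -> 0 < dot (F x) (F y))) => x Kx.
have c2 : {for (x, x), continuous (fun p : T * T => dot (F p.1) (F p.2))}.
  apply: dot_continuous.
  - by apply: (@continuous_comp _ _ _ fst F); [exact: cvg_fst|exact: cF].
  - by apply: (@continuous_comp _ _ _ snd F); [exact: cvg_snd|exact: cF].
have : \forall p \near (x, x), 0 < dot (F p.1) (F p.2).
  by apply: (@cvgr_gt _ _ _ _ (fun p : T * T => dot (F p.1) (F p.2)) _ c2); exact/dot_self_gt0/F0.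
case/nbhs_ballP => e /= e0 He.
have e20 : 0 < e / 2 by lra.
exists (ball x (e / 2), [set N | 2 / N%:R < e / 2]) => /=.
  split; first exact: nbhsx_ballx.
  near=> N => /=.
  have N4 : 4 / e < N%:R by near: N; exact: nbhs_infty_gtr.
  have N0 : 0 < N%:R :> R by apply: lt_trans N4; rewrite divr_gt0.
  by rewrite ltr_pdivrMr // mulrC; move: N4; rewrite ltr_pdivrMr //; lra.
case=> a N /= [xa Ne] y ay; apply: (He (a, y)); split => /=.
  by apply: le_ball xa; lra.
rewrite [e]splitr; apply: ball_triangle xa _.
by apply: le_ball ay; exact: ltW.
Unshelve. all: by end_near.
Qed.

Lemma walk_opp (f : nat -> plane) n : (forall i, (i < n)%N -> 0 < dot (f i) (f i.+1)) ->
  walk (fun i => - f i) n = walk f n (+) (turned (f 0%N) (+) turned (f n)).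
Proof.
elim: n => [|n IH] h; first by rewrite /walk !big_ord0 addbb.
rewrite !walkS (IH (fun i ni => h i (leqW ni))) flipN ?h //.
by case: (walk f n); case: flip; case: (turned (f 0%N)); case: (turned (f n)); case: turned.
Qed.

Lemma walk_rev (f : nat -> plane) n : walk (fun i => f (n - i)%N) n = walk f n.
Proof.
rewrite /walk (reindex_inj rev_ord_inj) /=; apply: eq_bigr => i _.
by rewrite flipC subnSK // !subKn // ltnW.
Qed.

Definition unit_square : set plane := `[0, 1] `*` `[0, 1].

Lemma grid_in (N i : nat) : (i <= N)%N -> (i%:R / N%:R : R) \in `[0, 1].
Proof.
move=> iN; rewrite in_itv /=; case: N iN => [|N] iN; first by rewrite invr0 mulr0 lexx ler01.
by rewrite divr_ge0 ?ler0n // ler_pdivrMr ?ltr0Sn // mul1r ler_nat.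
Qed.

Lemma grid_ball (N i : nat) : (i < N)%N -> ball (i%:R / N%:R : R) (2 / N%:R) (i.+1%:R / N%:R).
Proof.
move=> iN; rewrite /ball /= -mulrBl -opprB -natrB // subSnn mulNr normrN mul1r.
have N0 : 0 < N%:R :> R by rewrite ltr0n (leq_trans _ iN).
by rewrite gtr0_norm ?invr_gt0 // ltr_pMl ?invr_gt0 // ltr1n.
Qed.

Lemma path_dot_gt0_near (f : R -> plane) : continuous f ->
  (forall s, s \in `[0, 1] -> f s != 0) ->
  \forall N \near \oo, forall i, (i < N)%N -> 0 < dot (f (i%:R / N%:R)) (f (i.+1%:R / N%:R)).
Proof.
move=> cf f0.
have := dot_gt0_near (@segment_compact R 0 1) cf (fun x xK => f0 x xK).
apply: filterS => N HN i iN; apply: HN; last exact: grid_ball.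
exact: grid_in (ltnW iN).
Qed.

Definition square_walk (F : plane -> plane) (N : nat) : Prop :=
  walk (fun i => F (i%:R / N%:R, 0)) N (+) walk (fun j => F (1, j%:R / N%:R)) N =
  walk (fun j => F (0, j%:R / N%:R)) N (+) walk (fun i => F (i%:R / N%:R, 1)) N.

Lemma square_walk_near (F : plane -> plane) : continuous F ->
  (forall s t, s \in `[0, 1] -> t \in `[0, 1] -> F (s, t) != 0) ->
  \forall N \near \oo, square_walk F N.
Proof.
move=> cF F0.
have K : compact unit_square by apply: compact_setX; exact: segment_compact.
have F0' p : unit_square p -> F p != 0 by case: p => s t [] /= hs ht; apply: F0.
have near1 := dot_gt0_near K cF F0'.
near=> N.
have Npos : (0 < N)%N by near: N; exact: nbhs_infty_gt.
have HN : forall x, unit_square x -> forall y, ball x (2 / N%:R) y -> 0 < dot (F x) (F y).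
  by near: N.
have NN : N%:R / N%:R = 1 :> R by rewrite divff // pnatr_eq0 -lt0n.
rewrite /square_walk; have := @grid_walk R (fun i j => F (i%:R / N%:R, j%:R / N%:R)) N N.
rewrite NN !mul0r; apply => i j iN jN; apply: HN; rewrite /unit_square.
- by split; apply: grid_in => //; exact: ltnW.
- by split; [exact: grid_ball|apply: (@ballxx R R); rewrite divr_gt0 ?ltr0n].
- by split; apply: grid_in => //; exact: ltnW.
- by split; [apply: (@ballxx R R); rewrite divr_gt0 ?ltr0n|exact: grid_ball].
Unshelve. all: by end_near.
Qed.

(** The winding number along the boundary of the unit square, modulo 2. As [flip] is symmetric, the
    four sides need no orientation. *)
Definition boundary_parity (L : plane -> plane) (N : nat) : bool :=
  walk (fun i => L (i%:R / N%:R, 0)) N (+) walk (fun i => L (i%:R / N%:R, 1)) N (+)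
  (walk (fun j => L (0, j%:R / N%:R)) N (+) walk (fun j => L (1, j%:R / N%:R)) N).

(** [grid_walk] on the four side faces of the cube; the walks along the four common edges occur
    twice and cancel. *)
Lemma boundary_parity_homotopy (H : plane * R -> plane) : continuous H ->
  (forall s t u, s \in `[0, 1] -> t \in `[0, 1] -> u \in `[0, 1] ->
     [|| s == 0, s == 1, t == 0 | t == 1] -> H ((s, t), u) != 0) ->
  \forall N \near \oo,
    boundary_parity (fun p => H (p, 0)) N = boundary_parity (fun p => H (p, 1)) N.
Proof.
move=> cH H0.
have c1 (t : R) : continuous (fun p : plane => H ((p.1, t), p.2)).
  apply: cont_comp cH; apply: cont_pair; last exact: snd_continuous.
  by apply: cont_pair; [exact: fst_continuous|exact: cont_cst].
have c2 (t : R) : continuous (fun p : plane => H ((t, p.1), p.2)).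
  apply: cont_comp cH; apply: cont_pair; last exact: snd_continuous.
  by apply: cont_pair; [exact: cont_cst|exact: fst_continuous].
have i0 : (0 : R) \in `[0, 1] by rewrite in_itv /= lexx ler01.
have i1 : (1 : R) \in `[0, 1] by rewrite in_itv /= lexx ler01.
have n1 := square_walk_near (c1 0) (fun s u hs hu => H0 s 0 u hs i0 hu (introT or4P (Or43 _ _ _ (eqxx 0)))).
have n2 := square_walk_near (c1 1) (fun s u hs hu => H0 s 1 u hs i1 hu (introT or4P (Or44 _ _ _ (eqxx 1)))).
have n3 := square_walk_near (c2 0) (fun s u hs hu => H0 0 s u i0 hs hu (introT or4P (Or41 _ _ _ (eqxx 0)))).
have n4 := square_walk_near (c2 1) (fun s u hs hu => H0 1 s u i1 hs hu (introT or4P (Or42 _ _ _ (eqxx 1)))).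
near=> N.
have : square_walk (fun p => H ((p.1, 0), p.2)) N by near: N.
have : square_walk (fun p => H ((p.1, 1), p.2)) N by near: N.
have : square_walk (fun p => H ((0, p.1), p.2)) N by near: N.
have : square_walk (fun p => H ((1, p.1), p.2)) N by near: N.
rewrite /square_walk /boundary_parity /=.
repeat (let b := fresh "b" in set b := walk _ _; move: b => b).
move=> e1 e2 e3 e4.
have -> : b = b1 (+) b2 (+) b0 by rewrite -e1 addbK.
have -> : b3 = b5 (+) b6 (+) b4 by rewrite -e2 addbK.
have -> : b7 = b4 (+) b8 (+) b0 by rewrite -e3 addbK.
have -> : b9 = b5 (+) b10 (+) b1 by rewrite -e4 addbK.
by clear e1 e2 e3 e4; move: b0 b1 b2 b4 b5 b6 b8 b10; do 8!case.
Unshelve. all: by end_near.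
Qed.

(** Opposite sides carry opposite values, so by [walk_opp] they differ by values of [turned] at
    corners. What remains is [turned] at [L (1, 0)] and at its negative [L (0, 1)], which differ. *)
Lemma boundary_parity_odd (L : plane -> plane) : continuous L ->
  (forall s t, s \in `[0, 1] -> t \in `[0, 1] ->
     [|| s == 0, s == 1, t == 0 | t == 1] -> L (s, t) != 0) ->
  (forall s t, L (1 - s, 1 - t) = - L (s, t)) ->
  \forall N \near \oo, boundary_parity L N.
Proof.
move=> cL L0 Lodd.
have i0 : (0 : R) \in `[0, 1] by rewrite in_itv /= lexx ler01.
have c1 : continuous (fun s => L (s, 0)).
  by apply: cont_comp cL; apply: cont_pair; [move=> x; exact: cvg_id|exact: cont_cst].
have c2 : continuous (fun t => L (0, t)).
  by apply: cont_comp cL; apply: cont_pair; [exact: cont_cst|move=> x; exact: cvg_id].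
have n1 := path_dot_gt0_near c1 (fun s hs => L0 s 0 hs i0 (introT or4P (Or43 _ _ _ (eqxx 0)))).
have n2 := path_dot_gt0_near c2 (fun s hs => L0 0 s i0 hs (introT or4P (Or41 _ _ _ (eqxx 0)))).
near=> N.
have Npos : (0 < N)%N by near: N; exact: nbhs_infty_gt.
have h1 : forall i, (i < N)%N -> 0 < dot (L (i%:R / N%:R, 0)) (L (i.+1%:R / N%:R, 0)) by near: N.
have h2 : forall i, (i < N)%N -> 0 < dot (L (0, i%:R / N%:R)) (L (0, i.+1%:R / N%:R)) by near: N.
have NN : N%:R / N%:R = 1 :> R by rewrite divff // pnatr_eq0 -lt0n.
have opp i : (i <= N)%N -> (N - i)%:R / N%:R = 1 - i%:R / N%:R :> R.
  by move=> iN; rewrite natrB // mulrBl NN.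
have e1 : walk (fun i => L (i%:R / N%:R, 1)) N =
    walk (fun i => - L (i%:R / N%:R, 0)) N.
  rewrite -(walk_rev (fun i => L (i%:R / N%:R, 1))) /walk; apply: eq_bigr => i _.
  have e0 j : (j <= N)%N -> L ((N - j)%:R / N%:R, 1) = - L (j%:R / N%:R, 0).
    by move=> jN; rewrite opp // -Lodd subr0.
  by rewrite !e0 ?(ltnW (ltn_ord i)).
have e2 : walk (fun i => L (1, i%:R / N%:R)) N =
    walk (fun i => - L (0, i%:R / N%:R)) N.
  rewrite -(walk_rev (fun i => L (1, i%:R / N%:R))) /walk; apply: eq_bigr => i _.
  have e0 j : (j <= N)%N -> L (1, (N - j)%:R / N%:R) = - L (0, j%:R / N%:R).
    by move=> jN; rewrite opp // -Lodd subr0.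
  by rewrite !e0 ?(ltnW (ltn_ord i)).
rewrite /boundary_parity e1 e2 walk_opp // walk_opp // NN !mul0r.
have e3 : L (1, 0) = - L (0, 1) by rewrite -Lodd subr0 subrr.
rewrite e3 turnedN; last by apply: L0; rewrite ?in_itv /= ?lexx ?ler01 ?eqxx.
by case: (walk _ _); case: (walk _ _); case: turned; case: turned.
Unshelve. all: by end_near.
Qed.

(** The boundary parity of [a s - b t] in the shape of the crossing formula: each term depends on
    one arc and an endpoint of the other, or on two endpoints only. *)
Definition arc_index (a b : R -> plane) (N : nat) : bool :=
  walk (fun i => a (i%:R / N%:R) - b 0) N (+) walk (fun i => a (i%:R / N%:R) - b 1) N (+)
  (walk (fun j => b (j%:R / N%:R) - a 0) N (+) walk (fun j => b (j%:R / N%:R) - a 1) N) (+)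
  (turned (b 0 - a 0) (+) turned (b 0 - a 1) (+) (turned (b 1 - a 0) (+) turned (b 1 - a 1))).

Definition difference (a b : R -> plane) (p : plane) : plane := a p.1 - b p.2.

Lemma cont_plane_sub (T : topologicalType) (f g : T -> plane) :
  continuous f -> continuous g -> continuous (fun x => f x - g x).
Proof. by move=> cf cg x; exact: (cvgB (cf x) (cg x)). Qed.

Lemma difference_continuous (a b : R -> plane) :
  continuous a -> continuous b -> continuous (difference a b).
Proof.
by move=> ca cb; apply: cont_plane_sub; [apply: cont_comp ca|apply: cont_comp cb];
  [exact: fst_continuous|exact: snd_continuous].
Qed.

Lemma arc_index_boundary (a b : R -> plane) : continuous a -> continuous b ->
  (forall t, t \in `[0, 1] -> b t != a 0 /\ b t != a 1) ->
  \forall N \near \oo, boundary_parity (difference a b) N = arc_index a b N.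
Proof.
move=> ca cb ab.
have n0 : \forall N \near \oo, forall i, (i < N)%N ->
    0 < dot (b (i%:R / N%:R) - a 0) (b (i.+1%:R / N%:R) - a 0).
  apply: (@path_dot_gt0_near (fun t => b t - a 0)) => [|t /ab []]; last by rewrite subr_eq0.
  by apply: cont_plane_sub => //; exact: cont_cst.
have n1 : \forall N \near \oo, forall i, (i < N)%N ->
    0 < dot (b (i%:R / N%:R) - a 1) (b (i.+1%:R / N%:R) - a 1).
  apply: (@path_dot_gt0_near (fun t => b t - a 1)) => [|t /ab []]; last by rewrite subr_eq0.
  by apply: cont_plane_sub => //; exact: cont_cst.
near=> N.
have Npos : (0 < N)%N by near: N; exact: nbhs_infty_gt.
have NN : N%:R / N%:R = 1 :> R by rewrite divff // pnatr_eq0 -lt0n.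
have h0 : forall i, (i < N)%N ->
  0 < dot (b (i%:R / N%:R) - a 0) (b (i.+1%:R / N%:R) - a 0) by near: N.
have h1 : forall i, (i < N)%N ->
  0 < dot (b (i%:R / N%:R) - a 1) (b (i.+1%:R / N%:R) - a 1) by near: N.
rewrite /boundary_parity /arc_index /difference /=.
have -> : (fun j => a 0 - b (j%:R / N%:R)) = (fun j => - (b (j%:R / N%:R) - a 0)).
  by apply/funext => j; rewrite opprB.
have -> : (fun j => a 1 - b (j%:R / N%:R)) = (fun j => - (b (j%:R / N%:R) - a 1)).
  by apply/funext => j; rewrite opprB.
rewrite (walk_opp h0) (walk_opp h1) NN mul0r.
rewrite -!addbA; do 2!congr (_ (+) _).
by case: (walk _ _); case: (walk _ _); do 4!case: turned.
Unshelve. all: by end_near.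
Qed.

(** The difference has no zero on the whole square, so [grid_walk] makes its boundary parity
    vanish. *)
Lemma arc_index_disjoint (a b : R -> plane) : continuous a -> continuous b ->
  (forall s t, s \in `[0, 1] -> t \in `[0, 1] -> a s != b t) ->
  \forall N \near \oo, arc_index a b N = false.
Proof.
move=> ca cb ab.
have i0 : (0 : R) \in `[0, 1] by rewrite in_itv /= lexx ler01.
have i1 : (1 : R) \in `[0, 1] by rewrite in_itv /= lexx ler01.
have n1 := arc_index_boundary ca cb.
have {}n1 := n1 (fun t ht => conj (introN eqP (fun e => elimN eqP (ab 0 t i0 ht) (esym e)))
  (introN eqP (fun e => elimN eqP (ab 1 t i1 ht) (esym e)))).
have n2 := square_walk_near (difference_continuous ca cb).
have {}n2 := n2 (fun s t hs ht => introN eqP (fun e => elimN eqP (ab s t hs ht) (subr0_eq e))).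
near=> N.
have <- : boundary_parity (difference a b) N = arc_index a b N by near: N.
have : square_walk (difference a b) N by near: N.
rewrite /square_walk /boundary_parity.
by case: (walk _ _); case: (walk _ _); case: (walk _ _); case: (walk _ _).
Unshelve. all: by end_near.
Qed.
End Top.

(** * Parity at a proper crossing *)

Section Cross.
Variable R : realType.
Notation plane := (Real.sort R * Real.sort R)%type.

Lemma cont_id (T : topologicalType) : continuous (fun x : T => x).
Proof. by move=> x; exact: cvg_id. Qed.

Lemma cont_add (T : topologicalType) (f g : T -> R) :
  continuous f -> continuous g -> continuous (fun x => f x + g x).
Proof. by move=> cf cg x; exact: (cvgD (cf x) (cg x)). Qed.

Lemma cont_opp (T : topologicalType) (f : T -> R) :
  continuous f -> continuous (fun x => - f x).
Proof. by move=> cf x; exact: (cvgN (cf x)). Qed.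

Lemma cont_mul (T : topologicalType) (f g : T -> R) :
  continuous f -> continuous g -> continuous (fun x => f x * g x).
Proof. by move=> cf cg x; exact: (cvgM (cf x) (cg x)). Qed.

Lemma cont_fst (T U V : topologicalType) (f : T -> U * V) :
  continuous f -> continuous (fun x => (f x).1).
Proof. by move=> cf; apply: cont_comp cf _; exact: fst_continuous. Qed.

Lemma cont_snd (T U V : topologicalType) (f : T -> U * V) :
  continuous f -> continuous (fun x => (f x).2).
Proof. by move=> cf; apply: cont_comp cf _; exact: snd_continuous. Qed.

(** The retraction onto the unit interval, by which arcs extend to continuous maps on the line. *)
Definition clamp (x : R) : R := (1 + `|x| - `|x - 1|) / 2.

Lemma cont_clamp0 : continuous clamp.
Proof.
apply: cont_mul; last exact: cont_cst.
apply: cont_add.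
  apply: cont_add; first exact: cont_cst.
  by move=> x; exact: norm_continuous.
apply: cont_opp; apply: cont_comp; last by move=> x; exact: norm_continuous.
by apply: cont_add; [exact: cont_id|exact: cont_cst].
Qed.

Lemma cont_clamp (T : topologicalType) (f : T -> R) :
  continuous f -> continuous (fun x => clamp (f x)).
Proof. by move=> cf; exact: cont_comp cf cont_clamp0. Qed.

Lemma clamp_in x : clamp x \in `[0, 1].
Proof.
rewrite in_itv /= /clamp.
have [x0|x0] := leP 0 x; have [x1|x1] := leP 0 (x - 1).
- by rewrite (ger0_norm x0) (ger0_norm x1); apply/andP; split; lra.
- by rewrite (ger0_norm x0) (ltr0_norm x1); apply/andP; split; lra.
- by exfalso; lra.
- by rewrite (ltr0_norm x0) (ltr0_norm x1); apply/andP; split; lra.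
Qed.

Lemma clampK x : x \in `[0, 1] -> clamp x = x.
Proof.
rewrite in_itv /= => /andP[x0 x1]; rewrite /clamp (ger0_norm x0) ler0_norm; lra.
Qed.

Lemma within_comp_continuous (T U V : topologicalType) (A : set U) (f : U -> V) (g : T -> U) :
  {within A, continuous f} -> continuous g -> (forall x, A (g x)) -> continuous (fun x => f (g x)).
Proof.
move=> /subspace_continuousP cf cg gA x W fW.
have := cf _ (gA x) _ fW; rewrite /nbhs /= /within /= => nW.
have := cg x _ nW; rewrite /nbhs /=; apply: filterS => y /=.
exact.
Qed.

Lemma boundary_parity_ext (L L' : plane -> plane) N : (0 < N)%N ->
  (forall s t, s \in `[0, 1] -> t \in `[0, 1] -> L (s, t) = L' (s, t)) ->
  boundary_parity L N = boundary_parity L' N.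
Proof.
move=> N0 LL; rewrite /boundary_parity /walk.
have i0 : (0 : R) \in `[0, 1] by rewrite in_itv /= lexx ler01.
have i1 : (1 : R) \in `[0, 1] by rewrite in_itv /= lexx ler01.
by congr (_ (+) _ (+) (_ (+) _)); apply: eq_bigr => i _; rewrite !LL //; apply: grid_in => //; exact: ltnW.
Qed.

Lemma monotone_sign (f : R -> R) (s0 : R) : continuous f -> {in `[0, 1] &, injective f} ->
  s0 \in `]0, 1[ -> f s0 = 0 -> exists2 e : R, e ^+ 2 = 1 & f 0 * e < 0 /\ 0 < f 1 * e.
Proof.
move=> cf fi; rewrite in_itv /= => /andP[s0p s01] f0.
have i0 : (0 : R) \in `[0, 1] by rewrite in_itv /= lexx ler01.
have i1 : (1 : R) \in `[0, 1] by rewrite in_itv /= lexx ler01.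
have i2 : s0 \in `[0, 1] by rewrite in_itv /= !ltW.
have cf' : {within `[0, 1], continuous f} by exact: continuous_subspaceT.
have [m|m] := itv_continuous_inj_mono cf' fi.
- exists 1; first by rewrite expr1n.
  by rewrite !mulr1; split; [rewrite -[X in _ < X]f0 m|rewrite -[X in X < _]f0 m].
- exists (- 1); first by rewrite sqrrN expr1n.
  by rewrite !mulrN1 oppr_lt0 oppr_gt0; split; [rewrite -[X in X < _]f0 m|rewrite -[X in _ < X]f0 m].
Qed.

Ltac cont := repeat first [assumption | lazymatch goal with
  | |- forall y, continuous_at y (fun x => (@?f x, @?g x)) => apply: cont_pair
  | |- forall y, continuous_at y (fun x => clamp (@?f x)) => apply: cont_clamp
  | |- forall y, continuous_at y (fun x => @Algebra.add _ (@?f x) (@?g x)) => apply: cont_add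
  | |- forall y, continuous_at y (fun x => @Algebra.opp _ (@?f x)) => apply: cont_opp
  | |- forall y, continuous_at y (fun x => @GRing.mul _ (@?f x) (@?g x)) => apply: cont_mul
  | |- forall y, continuous_at y (fun x => fst (@?f x)) => apply: cont_fst
  | |- forall y, continuous_at y (fun x => snd (@?f x)) => apply: cont_snd
  | |- forall y, continuous_at y clamp => exact: cont_clamp0
  | |- forall y, continuous_at y fst => exact: fst_continuous
  | |- forall y, continuous_at y snd => exact: snd_continuous
  | |- forall y, continuous_at y (fun x => x) => exact: cont_id
  | |- forall y, continuous_at y (fun x => ?c) => exact: cont_cst
  end].

(** A number of sign [w] can be moved to [w] along a segment that avoids 0. *)
Lemma sign_homotopy (u w x : R) : 0 <= u -> u <= 1 -> w ^+ 2 = 1 -> 0 < x * w ->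
  (1 - u) * x + u * w = 0 -> False.
Proof.
move=> u0 u1 w2 xw /(congr1 ( *%R^~ w)); rewrite mul0r mulrDl -!mulrA -expr2 w2 mulr1.
have v0 : 0 <= 1 - u by lra.
have p0 := mulr_ge0 v0 (ltW xw) => E.
have ue : u = 0 by lra.
by move: E; rewrite ue subr0 mul1r addr0 => E; rewrite E ltxx in xw.
Qed.

Lemma segment_shrink (c m s : R) : c \in `[0, 1] -> m \in `[0, 1] -> s \in `[0, 1] ->
  c + m * (s - c) \in `[0, 1].
Proof.
rewrite !in_itv /= => /andP[c0 c1] /andP[m0 m1] /andP[x0 x1].
have -> : c + m * (s - c) = (1 - m) * c + m * s by ring.
have m1' : 0 <= 1 - m by lra.
have p1 := mulr_ge0 m1' c0; have p2 := mulr_ge0 m0 x0.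
have p3 : (1 - m) * c <= (1 - m) * 1 by apply: ler_wpM2l.
have p4 : m * s <= m * 1 by apply: ler_wpM2l.
by apply/andP; split; lra.
Qed.

(** The crossing is the only zero of the difference and lies inside the square, so the boundary loop
    can be deformed into an odd one, to which [boundary_parity_odd] applies. *)
Lemma arc_index_crossing (a b : R -> plane) (s0 t0 : R) (U : set plane) (h g : plane -> plane) :
  continuous a -> continuous b ->
  {in `[0, 1] &, injective a} -> {in `[0, 1] &, injective b} ->
  s0 \in `]0, 1[ -> t0 \in `]0, 1[ -> a s0 = b t0 ->
  (forall s t, s \in `[0, 1] -> t \in `[0, 1] -> a s = b t -> s = s0 /\ t = t0) ->
  open U -> U (a s0) -> {within U, continuous h} -> continuous g ->
  (forall x, U x -> g (h x) = x) -> (forall y, h (g y) = y) -> h (a s0) = (0, 0) ->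
  (forall s, s \in `[0, 1] -> U (a s) -> (h (a s)).2 = 0) ->
  (forall t, t \in `[0, 1] -> U (b t) -> (h (b t)).1 = 0) ->
  \forall N \near \oo, arc_index a b N = true.
Proof.
move=> ca cb ia ib hs0 ht0 ab0 ab oU Uas ch cg gK hK h0 ha hb.
have i0 : (0 : R) \in `[0, 1] by rewrite in_itv /= lexx ler01.
have i1 : (1 : R) \in `[0, 1] by rewrite in_itv /= lexx ler01.
move: (hs0) (ht0); rewrite !in_itv /= => /andP[s0p s01] /andP[t0p t01].
have is0 : s0 \in `[0, 1] by rewrite in_itv /= !ltW.
have it0 : t0 \in `[0, 1] by rewrite in_itv /= !ltW.
have [e e0 [Ua Ub]] : exists2 e : R, 0 < e & (forall s, ball s0 e s -> U (a s)) /\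
    (forall t, ball t0 e t -> U (b t)).
  have na : \forall s \near s0, U (a s) by apply: ca; exact: open_nbhs_nbhs.
  have nb : \forall t \near t0, U (b t) by apply: cb; apply: open_nbhs_nbhs; rewrite -ab0.
  case/nbhs_ballP: na => e1 /= e10 H1; case/nbhs_ballP: nb => e2 /= e20 H2.
  exists (Num.min e1 e2); first by rewrite lt_min e10.
  by split=> s hs; [apply: H1|apply: H2]; apply: le_ball hs; rewrite ge_min lexx ?orbT.
(* Shrinking by [k] towards [s0] and [t0] keeps both arcs in the chart [U]. *)
pose k := Num.min (1 / 2) (e / 2).
have k0 : 0 < k by rewrite lt_min !divr_gt0.
have k1 : k <= 1 / 2 by rewrite ge_min lexx.
have ke : k <= e / 2 by rewrite ge_min lexx orbT.
pose shrink (c s : R) := c + k * (clamp s - c).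
have sh_ball (c s : R) : c \in `[0, 1] -> ball c e (shrink c s).
  have := clamp_in s; rewrite !in_itv /= => /andP[x0 x1] /andP[c0 c1].
  rewrite /ball /= /shrink opprD addrA subrr sub0r normrN normrM (gtr0_norm k0).
  have d1 : `|clamp s - c| <= 1 by rewrite ler_norml; apply/andP; split; lra.
  by apply: (le_lt_trans (ler_wpM2l (ltW k0) d1)); lra.
have sh_in (c s : R) : c \in `[0, 1] -> shrink c s \in `[0, 1].
  by move=> hc; apply: segment_shrink (clamp_in _) => //; rewrite in_itv /=; apply/andP; split; lra.
have csh (c : R) : continuous (shrink c).
  by rewrite /shrink; cont.
have sh_inj (c s s' : R) : s \in `[0, 1] -> s' \in `[0, 1] -> shrink c s = shrink c s' -> s = s'.
  move=> hs hs'; rewrite /shrink !clampK // => /addrI /(mulfI (lt0r_neq0 k0)).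
  exact: addIr.
have sh_fix (c : R) : c \in `[0, 1] -> shrink c c = c.
  by move=> hc; rewrite /shrink clampK // subrr mulr0 addr0.
pose al (s : R) := (h (a (shrink s0 s))).1.
pose be (t : R) := (h (b (shrink t0 t))).2.
have cal : continuous al.
  apply: cont_fst; apply: (within_comp_continuous ch) => [|s]; last exact/Ua/sh_ball.
  exact: cont_comp (csh _) ca.
have cbe : continuous be.
  apply: cont_snd; apply: (within_comp_continuous ch) => [|s]; last exact/Ub/sh_ball.
  exact: cont_comp (csh _) cb.
have aE (s : R) : s \in `[0, 1] -> a (shrink s0 s) = g (al s, 0).
  move=> hs; rewrite -[LHS]gK; last exact/Ua/sh_ball.
  by rewrite /al -(ha (shrink s0 s)) ?sh_in //; [case: (h _)|exact/Ua/sh_ball].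
have bE (t : R) : t \in `[0, 1] -> b (shrink t0 t) = g (0, be t).
  move=> ht; rewrite -[LHS]gK; last exact/Ub/sh_ball.
  by rewrite /be -(hb (shrink t0 t)) ?sh_in //; [case: (h _)|exact/Ub/sh_ball].
have ial : {in `[0, 1] &, injective al}.
  move=> s s' hs hs' E; apply: (sh_inj s0) => //; apply: ia; rewrite ?sh_in //.
  by rewrite !aE // E.
have ibe : {in `[0, 1] &, injective be}.
  move=> s s' hs hs' E; apply: (sh_inj t0) => //; apply: ib; rewrite ?sh_in //.
  by rewrite !bE // E.
have al0 : al s0 = 0 by rewrite /al sh_fix // h0.
have be0 : be t0 = 0 by rewrite /be sh_fix // -ab0 h0.
have [ea ea2 [ea0 ea1]] := monotone_sign cal ial hs0 al0.
have [eb eb2 [eb0 eb1]] := monotone_sign cbe ibe ht0 be0.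
have albe (s t : R) : s \in `[0, 1] -> t \in `[0, 1] -> al s = 0 -> be t = 0 -> s = s0 /\ t = t0.
  by move=> hs ht es et; split; [apply: ial => //; rewrite es al0|apply: ibe => //; rewrite et be0].
pose bnd (s t : R) := [|| s == 0, s == 1, t == 0 | t == 1].
have bnd_ne (s t : R) : bnd s t -> ~ (s = s0 /\ t = t0).
  move=> hbd [es et]; move: hbd; rewrite /bnd es et.
  by rewrite (gt_eqF s0p) (lt_eqF s01) (gt_eqF t0p) (lt_eqF t01).
have n1 : \forall N \near \oo, boundary_parity (difference a b) N = arc_index a b N.
  apply: arc_index_boundary => // t ht; split; apply/eqP => E.
    by case: (ab _ _ i0 ht (esym E)) => e1 _; move: s0p; rewrite -e1 ltxx.
  by case: (ab _ _ i1 ht (esym E)) => e1 _; move: s01; rewrite -e1 ltxx.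
(* [H1] contracts the square towards the crossing, where [h] applies; [H2] moves the pair
   [(al, 0), (0, be)] to an antipodal one by translations; [H3] makes the loop odd. *)
pose H1 (p : plane * R) : plane :=
  a (s0 + (1 - p.2 * (1 - k)) * (clamp p.1.1 - s0)) - b (t0 + (1 - p.2 * (1 - k)) * (clamp p.1.2 - t0)).
have n2 := @boundary_parity_homotopy _ H1.
have {}n2 : \forall N \near \oo,
    boundary_parity (fun p => H1 (p, 0)) N = boundary_parity (fun p => H1 (p, 1)) N.
  apply: n2.
    rewrite /H1; apply: cont_plane_sub; [apply: cont_comp ca|apply: cont_comp cb]; cont.
  move=> s t u hs ht hu hst; rewrite /H1 /= !clampK //; apply/eqP => /subr0_eq.
  move: (hu); rewrite in_itv /= => /andP[u1 u2].
  have k1' : 0 <= 1 - k by clear -k1; lra.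
  have uk : u * (1 - k) <= 1 * (1 - k) by exact: ler_wpM2r.
  have uk0 : 0 <= u * (1 - k) by exact: mulr_ge0.
  set m := 1 - u * (1 - k).
  have mi : m \in `[0, 1] by rewrite in_itv /= /m; clear -uk uk0 k0; apply/andP; split; lra.
  have mp : m != 0 by rewrite lt0r_neq0 // /m; clear -uk uk0 k0; lra.
  case/ab; try exact: segment_shrink.
  move=> /eqP; rewrite -subr_eq0 addrC addKr mulf_eq0 (negbTE mp) /= subr_eq0 => /eqP es.
  move=> /eqP; rewrite -subr_eq0 addrC addKr mulf_eq0 (negbTE mp) /= subr_eq0 => /eqP et.
  by case: (bnd_ne s t hst).
pose H2 (p : plane * R) : plane :=
  g (al p.1.1 - p.2 / 2 * al p.1.1, - (p.2 / 2 * be p.1.2)) -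
  g (- (p.2 / 2 * al p.1.1), be p.1.2 - p.2 / 2 * be p.1.2).
have g_inj y y' : g y = g y' -> y = y' by move=> E; rewrite -(hK y) E hK.
have cal' (T : topologicalType) (f : T -> R) : continuous f -> continuous (fun x => al (f x)).
  by move=> cf; exact: cont_comp cf cal.
have cbe' (T : topologicalType) (f : T -> R) : continuous f -> continuous (fun x => be (f x)).
  by move=> cf; exact: cont_comp cf cbe.
have n3 : \forall N \near \oo,
    boundary_parity (fun p => H2 (p, 0)) N = boundary_parity (fun p => H2 (p, 1)) N.
  apply: boundary_parity_homotopy.
    rewrite /H2; apply: cont_plane_sub; apply: cont_comp cg; cont; (apply: cal' || apply: cbe'); cont.
  move=> s t u hs ht hu hst; rewrite /H2 /=; apply/eqP => /subr0_eq /g_inj [e1 e2].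
  by apply: (bnd_ne s t hst); apply: albe => //; clear -e1 e2; lra.
(* [K] is odd and vanishes only at 0, as [g] is injective. At time 1 the loop [H2] is [K] of
   [(al, - be)]. *)
pose K (z : plane) : plane := g (z.1 / 2, z.2 / 2) - g (- (z.1 / 2), - (z.2 / 2)).
have cK : continuous K.
  by rewrite /K; apply: cont_plane_sub; apply: cont_comp cg; cont.
have K0 z : K z = 0 -> z = 0.
  by case: z => x y /subr0_eq /g_inj [/= e1 e2]; congr pair; clear -e1 e2; lra.
pose H3 (p : plane * R) : plane :=
  K ((1 - p.2) * al p.1.1 + p.2 * (ea * (2 * p.1.1 - 1)),
     - ((1 - p.2) * be p.1.2 + p.2 * (eb * (2 * p.1.2 - 1)))).
have n4 : \forall N \near \oo,
    boundary_parity (fun p => H3 (p, 0)) N = boundary_parity (fun p => H3 (p, 1)) N.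
  apply: boundary_parity_homotopy.
    by rewrite /H3; apply: cont_comp cK; cont; (apply: cal' || apply: cbe'); cont.
  move=> s t u hs ht hu hst; apply/eqP => /K0 [e1 e2].
  move: hu; rewrite in_itv /= => /andP[u1 u2].
  move/eqP: e2; rewrite oppr_eq0 => /eqP e2.
  have w1 : 2 * 1 - 1 = 1 :> R by ring.
  have w0 : 2 * 0 - 1 = - 1 :> R by ring.
  case/or4P: hst => /eqP E; move: e1 e2; rewrite E ?w0 ?w1 ?mulr1 ?mulrN1 => e1 e2.
  - by apply: sign_homotopy e1; rewrite ?sqrrN // mulrN oppr_gt0.
  - by apply: sign_homotopy e1.
  - by apply: sign_homotopy e2; rewrite ?sqrrN // mulrN oppr_gt0.
  - by apply: sign_homotopy e2.
have n5 : \forall N \near \oo, boundary_parity (fun p => H3 (p, 1)) N.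
  apply: boundary_parity_odd.
  - by rewrite /H3; apply: cont_comp cK; cont; (apply: cal' || apply: cbe'); cont.
  - move=> s t hs ht hst; apply/eqP => /K0 [/eqP + /eqP].
    rewrite subrr !mul0r !add0r !mul1r oppr_eq0 !mulf_eq0.
    have -> : (ea == 0) = false by apply/negbTE; rewrite -sqrf_eq0 ea2 oner_eq0.
    have -> : (eb == 0) = false by apply/negbTE; rewrite -sqrf_eq0 eb2 oner_eq0.
    move=> /= /eqP e1 /eqP e2.
    by case/or4P: hst => /eqP E; move: e1 e2; rewrite E; clear; lra.
  - by move=> s t; rewrite /H3 /K /= opprB; congr (g (_, _) - g (_, _)); field.
near=> N.
have Npos : (0 < N)%N by near: N; exact: nbhs_infty_gt.
have <- : boundary_parity (difference a b) N = arc_index a b N by near: N.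
have E1 : boundary_parity (fun p => H1 (p, 0)) N = boundary_parity (fun p => H1 (p, 1)) N by near: N.
have E2 : boundary_parity (fun p => H2 (p, 0)) N = boundary_parity (fun p => H2 (p, 1)) N by near: N.
have E3 : boundary_parity (fun p => H3 (p, 0)) N = boundary_parity (fun p => H3 (p, 1)) N by near: N.
have E4 : boundary_parity (fun p => H3 (p, 1)) N by near: N.
rewrite -E4 -E3.
transitivity (boundary_parity (fun p => H1 (p, 0)) N).
  apply: boundary_parity_ext => // s t hs ht; rewrite /difference /H1 /= !clampK //.
  by rewrite mul0r subr0 !mul1r !subrKC.
rewrite E1; transitivity (boundary_parity (fun p => H2 (p, 0)) N).
  apply: boundary_parity_ext => // s t hs ht; rewrite /H1 /H2 /= !mul1r !mul0r !subr0 oppr0.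
  by rewrite -aE // -bE // /shrink opprB subrKC.
rewrite E2; apply: boundary_parity_ext => // s t hs ht; rewrite /H2 /H3 /K /=.
by congr (g (_, _) - g (_, _)); field.
Unshelve. all: by end_near.
Qed.
End Cross.

(** * Crossing parity in a simple drawing *)

Section Drawing.
Variable R : realType.
Notation plane := (Real.sort R * Real.sort R)%type.
Variable G : drawing R.
Hypothesis Gtop : topological_graph G.
Hypothesis Gsimple : simple_drawing G.

Definition arc_of (e : {set vertex G}) (c : R -> plane) : Prop :=
  [/\ continuous c, {in `[0, 1] &, injective c}, edge_arc e = c @` `[0, 1] &
   exists u w, [/\ e = [set u; w]%SET, c 0 = vertex_point u & c 1 = vertex_point w]].

Lemma arc_of_edge e : e \in edges G -> exists c, arc_of e c.
Proof.
move=> eE; have /eqP/cards2P [u [w [uw E]]] := edges_card2 eE.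
move: eE; rewrite E => eE.
have [c [cc ci c0 c1 ce]] := edge_arcP eE.
exists (fun s => c (clamp s)); split.
- by apply: (within_comp_continuous cc) => [|s]; [exact: cont_clamp0|exact: clamp_in].
- by move=> s s' hs hs'; rewrite !clampK //; exact: ci.
- rewrite ce; apply/seteqP; split => p [s hs <-]; exists s => //; by rewrite ?clampK.
- by exists u, w; rewrite !clampK ?in_itv /= ?lexx ?ler01.
Qed.

Lemma interior_of_inter e f p : e \in edges G -> f \in edges G -> [disjoint e & f]%B ->
  edge_arc e p -> edge_arc f p -> (edge_interior e `&` edge_interior f) p.
Proof.
move=> eE fE ef ep fp; have [av _ _ _] := Gtop.
split; split => //= -[v /= vi E].
  have := av f v fE; rewrite E => /(_ fp) vf.
  by have := disjointFr ef vi; rewrite vf.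
have := av e v eE; rewrite E => /(_ ep) ve.
by have := disjointFr ef ve; rewrite vi.
Qed.

(** Vertex-disjoint edges either have disjoint arcs or, by simplicity, share exactly one point,
    which is interior to both and hence a proper crossing. *)
Lemma arc_index_edges e f c d : e \in edges G -> f \in edges G -> [disjoint e & f]%B ->
  arc_of e c -> arc_of f d ->
  \forall N \near \oo, arc_index c d N = `[< edges_cross e f >].
Proof.
move=> eE fE ef ac ad; have [cc ci ce [u [w [euw c0 c1]]]] := ac.
have [dc di de [x [y [fxy d0 d1]]]] := ad.
have ne : e != f.
  apply/eqP => E; have ue : u \in e by rewrite euw set21.
  by have := disjointFr ef ue; rewrite -E ue.
have fe : [disjoint f & e]%B by rewrite disjoint_sym.
have i0 : (0 : R) \in `[0, 1] by rewrite in_itv /= lexx ler01.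
have i1 : (1 : R) \in `[0, 1] by rewrite in_itv /= lexx ler01.
case: asboolP => [[p [[ep nep] [fp nfp]]]|nx]; last first.
  apply: arc_index_disjoint => // s t hs ht; apply/eqP => E; apply: nx.
  exists (c s); apply: interior_of_inter => //; first by rewrite ce; exists s.
  by rewrite de E; exists t.
have [_ _ _ /(_ e f p eE fE ne)] := Gtop.
case; first by split.
move=> U [h [g [[oU Up] [ch cg] gK hK [hp he hf]]]].
move: (ep) (fp); rewrite ce de => -[s0 hs0 cs0] [t0 ht0 dt0].
have interior (b : R -> plane) (s : R) e' v v' : arc_of e' b -> e' \in edges G -> 
    b 0 = vertex_point v -> b 1 = vertex_point v' ->  e' = [set v; v']%SET -> s \in `[0, 1] ->
    b s = p -> edge_interior e' p -> s \in `]0, 1[.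
  move=> _ _ b0 b1 e'E hs bs [_ np]; move: hs; rewrite !in_itv /= !le_eqVlt.
  case/andP => /orP[/eqP z|->] /orP[/eqP z'|->] //; exfalso; apply: np => /=.
  - by exists v; rewrite /= ?e'E ?inE ?eqxx // -b0 z.
  - by exists v; rewrite /= ?e'E ?inE ?eqxx // -b0 z.
  - by exists v'; rewrite /= ?e'E ?inE ?eqxx ?orbT // -b1 -z'.
have {}hs0' : s0 \in `]0, 1[ by apply: (interior c s0 e u w).
have {}ht0' : t0 \in `]0, 1[ by apply: (interior d t0 f x y).
apply: (arc_index_crossing (s0 := s0) (t0 := t0) (U := U) (h := h) (g := g)) => //.
- by rewrite cs0 dt0.
- move=> s t hs ht E; have Es : c s = p.
    by apply: (Gsimple eE fE ne); split; rewrite ?ce ?de; [exists s|rewrite E; exists t|exists s0|exists t0].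
  split; [apply: ci => //; by rewrite Es cs0|apply: di => //; by rewrite -E Es dt0].
- by rewrite cs0.
- by move=> z; have [] := hK z.
- by rewrite cs0.
- move=> s hs Us; have : [set z : plane | z.2 = 0] (h (c s)).
    by rewrite -he; exists (c s) => //; split => //; rewrite ce; exists s.
  exact.
- move=> s hs Us; have : [set z : plane | z.1 = 0] (h (d s)).
    by rewrite -hf; exists (d s) => //; split => //; rewrite de; exists s.
  exact.
Qed.

Lemma set2_inj (T : finType) (u w a b : T) : [set u; w]%SET = [set a; b]%SET ->
  (u = a /\ w = b) \/ (u = b /\ w = a).
Proof.
move=> E.
have : u \in [set a; b]%SET by rewrite -E set21.
have : w \in [set a; b]%SET by rewrite -E set22.
have : a \in [set u; w]%SET by rewrite E set21.
have : b \in [set u; w]%SET by rewrite E set22.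
rewrite {E} !inE.
by do 4![case/orP => /eqP ?]; subst; auto.
Qed.

(** One subdivision [N] serves all of the finitely many pairs of edges. Then [x e v] is the walk
    along the arc of [e] seen from [v], and [turnedN] makes [B] a tournament. *)
Lemma crossing_parity : exists (x : {set vertex G} -> vertex G -> bool) (B : rel (vertex G)),
  (forall u v, u != v -> B u v = ~~ B v u) /\
  forall u w a b, [set u; w]%SET \in edges G -> [set a; b]%SET \in edges G ->
    [disjoint [set u; w]%SET & [set a; b]%SET]%B ->
    `[< edges_cross [set u; w]%SET [set a; b]%SET >] =
      x [set u; w]%SET a (+) x [set u; w]%SET b (+) (x [set a; b]%SET u (+) x [set a; b]%SET w)
      (+) (B u a (+) B u b (+) (B w a (+) B w b)).
Proof.
have ex_arc e : exists c, e \in edges G -> arc_of e c.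
  have [eE|ne] := boolP (e \in edges G); last by exists (fun=> 0).
  by have [c] := arc_of_edge eE; exists c.
have [c hc] := choice ex_arc.
pose P (ef : {set vertex G} * {set vertex G}) (N : nat) : Prop :=
   ef.1 \in edges G -> ef.2 \in edges G -> [disjoint ef.1 & ef.2]%B ->
   arc_index (c ef.1) (c ef.2) N = `[< edges_cross ef.1 ef.2 >].
have nP ef : \forall N \near \oo, P ef N.
  case: ef => e f; rewrite /P /=.
  have [[eE fE ef]|] := pselect [/\ e \in edges G, f \in edges G & [disjoint e & f]%B].
    have := arc_index_edges eE fE ef (hc e eE) (hc f fE).
    by apply: filterS => N E _ _ _.
  by move=> ne; apply: nearW => N eE fE ef; case: ne.
have nA : \forall N \near \oo, forall ef, P ef N by exact: filter_forall.
have [N HN2] : exists N : nat, forall ef, P ef N by near \oo => N; exists N; near: N.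
exists (fun e v => walk (fun i => c e (i%:R / N%:R) - vertex_point v) N).
exists (fun u v => turned (vertex_point v - vertex_point u)); split.
  move=> u v uv; rewrite -opprB turnedN // subr_eq0; apply: contra uv => /eqP E.
  exact/eqP/vertex_point_inj.
move=> u w a b eE fE ef; rewrite -(HN2 ([set u; w]%SET, [set a; b]%SET)) // /arc_index /=.
have [_ _ _ [u' [w' [/set2_inj euw -> ->]]]] := hc _ eE.
have [_ _ _ [a' [b' [/set2_inj fab -> ->]]]] := hc _ fE.
(* An arc may be parametrised from either end; the formula is symmetric in the two ends of each
   edge. *)
case: euw => -[<- <-]; case: fab => -[<- <-];
  repeat (let b := fresh "b" in set b := walk _ _; move: b => b);
  repeat (let b := fresh "b" in set b := turned _; move: b => b);
  clear; repeat match goal with b : bool |- _ => destruct b end; reflexivity.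
Unshelve. all: by end_near.
Qed.
End Drawing.

End PlaneParity.

(** * From the combinatorial bound to drawings *)

Local Open Scope ring_scope.

Theorem theorem1p1 (R : realType) (t : nat) (ht : (1 <= t)%N) :
  exists c : R, forall n : nat, (1 <= n)%N ->
    forall G : drawing R,
      topological_graph G -> simple_drawing G -> #|vertex G| = n ->
      ~ (exists A B : {set {set vertex G}},
           [/\ A \subset edges G, B \subset edges G, #|A| = t, #|B| = t &
               forall e f : {set vertex G}, e \in A -> f \in B ->
                 edges_disjoint e f]) ->
      #|edges G|%:R <= c * n%:R.
Proof.
have [c hc] := linear_of_no_disjoint_grid ht.
exists c%:R => n n1 G Gtop Gsimple Vn noK; rewrite -Vn -natrM ler_nat.
have [x [B [Bt crE]]] := crossing_parity Gtop Gsimple.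
apply: (hc _ _ (@edges_card2 _ G) (fun e f => `[< edges_cross e f >]) x B Bt crE).
move=> A A' AE A'E cA cA'; apply: contrapT => no; apply: noK.
exists A, A'; split => // e f eA fA'.
have /andP[ef /asboolPn nx] : [disjoint e & f] && ~~ `[< edges_cross e f >].
  by apply: contrapT => /negP h; apply: no; exists e, f.
by split => //; exact: disjoint_setI0.
Qed.
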